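(* Let $\mathbf M\in\{\mathbf T,\mathbf{SL}\}$ and let $\mathbf N$ be a nil-variety of semigroups [respectively, epigroups] satisfying the following three conditions. (a) For each non-substitutive identity $\mathbf u\approx\mathbf v$ which holds in $\mathbf N$, the identities $\mathbf u\approx 0$ and $\mathbf v\approx 0$ also hold in $\mathbf N$. (b) For each word $\mathbf u$, if $\mathbf N$ does not satisfy $\mathbf u\approx 0$, then $\mathrm{Stab}_{\mathbf N}(\mathbf u)$ is a modular element of the lattice $\mathrm{Sub}(S(\mathrm{alph}(\mathbf u)))$. (c') There are no non-equivalent words $\mathbf u$ and $\mathbf v$ such that $\mathrm{alph}(\mathbf u)=\mathrm{alph}(\mathbf v)$ and one of the following holds: (1) the common alphabet has 3 letters and $\mathrm{Stab}_{\mathbf N}(\mathbf u),\mathrm{Stab}_{\mathbf N}(\mathbf v)\in\{T_{12},T_{23},T_{13}\}$; (2) the common alphabet has 3 letters, $\mathrm{Stab}_{\mathbf N}(\mathbf u)\in\{T_{12},T_{23},T_{13}\}$ and $\mathrm{Stab}_{\mathbf N}(\mathbf v)=A_3$; (3) the common alphabet has 4 letters and $\mathrm{Stab}_{\mathbf N}(\mathbf u),\mathrm{Stab}_{\mathbf N}(\mathbf v)\in\{I_{12,34},I_{13,24},I_{14,23}\}$; (4) the common alphabet has 4 letters, $\mathrm{Stab}_{\mathbf N}(\mathbf u)\in\{I_{12,34},I_{13,24},I_{14,23}\}$ and $\mathrm{Stab}_{\mathbf N}(\mathbf v)=A_4$. Then $\mathbf V=\mathbf M\vee\mathbf N$ is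 a modular element of the lattice $\mathbb{SEM}$ [respectively, $\mathbb{EPI}$].
   Context: An element $x$ of a lattice $L$ is modular if for all $y,z\in L$ with $y\le z$ one has $(x\vee y)\wedge z=(x\wedge z)\vee y$. A variety is a class of algebras of a fixed type closed under homomorphic images, subalgebras and direct products. $\mathbb{SEM}$ is the lattice of all semigroup varieties under inclusion. An epigroup is a semigroup $S$ in which every element $x$ has a power lying in some subgroup of $S$. If $e_x$ is the unit of the maximal subgroup $G$ containing some power of $x$, then $xe_x=e_xx\in G$, and $\overline x$ (the pseudoinverse of $x$) is the inverse of $xe_x$ in $G$. Epigroups are treated as algebras with multiplication and the unary operation $x\mapsto\overline x$; an epigroup variety is a variety of such algebras consisting of epigroups, and $\mathbb{EPI}$ is the lattice of all epigroup varieties under inclusion. $\mathbf T$ is the trivial variety; $\mathbf{SL}$ is the variety of semilattices, given by $x^2\approx x$, $xy\approx yx$. A nilsemigroup is a semigroup with zero $0$ such that every element $s$ satisfies $s^n=0$ for some positive integer $n$. A nil-variety is a variety consisting of nilsemigroups. Periodic epigroup varieties (in particular nil-varieties) are identified with periodic semigroup varieties, since there pseudoinversion is expressible through multiplication; accordingly only semigroup words and identities are considered. $F$ is the free semigroup of countably infinite rank, $F^1$ the free monoid. Words are elements of $F$; $\mathrm{alph}(\mathbf w)$ is the set of letters occurring in $\mathbf w$. The expression $\mathbf w\approx0$ denotes the identity system $\mathbf wx\approx x\mathbf w\approx\mathbf w$, where $x$ is a letter not occurring in $\mathbf w$. An identity $\mathbf u\approx\mathbf v$ is substitutive if $\mathrm{alph}(\mathbf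 u)=\mathrm{alph}(\mathbf v)$ and $\mathbf v$ is obtained from $\mathbf u$ by renaming letters (i.e. by a permutation of $\mathrm{alph}(\mathbf u)$). For words $\mathbf u,\mathbf v$ write $\mathbf u\le\mathbf v$ if $\mathbf v=\mathbf a\,\xi(\mathbf u)\,\mathbf b$ for some endomorphism $\xi$ of $F$ and some $\mathbf a,\mathbf b\in F^1$. Words $\mathbf u,\mathbf v$ are equivalent if $\mathbf u\le\mathbf v$ and $\mathbf v\le\mathbf u$; equivalently, $\mathbf v=\varphi(\mathbf u)$ for some automorphism $\varphi$ of $F$. $S(X)$ is the symmetric group on a set $X$, $S_n=S(\{1,\dots,n\})$, and $\mathrm{Sub}(G)$ is the subgroup lattice of $G$. For a variety $\mathbf N$ and a word $\mathbf u$, $\mathrm{Stab}_{\mathbf N}(\mathbf u)=\{\sigma\in S(\mathrm{alph}(\mathbf u))\mid \mathbf u\approx\sigma(\mathbf u)\text{ holds in }\mathbf N\}$, where $\sigma$ acts on words by renaming letters; this is a subgroup of $S(\mathrm{alph}(\mathbf u))$. In (c'), the common alphabet is $\{x_1,\dots,x_k\}$ ($k=3$ or $4$), its letters being identified with $1,\dots,k$ by some enumeration (the same for $\mathbf u$ and $\mathbf v$), so that the stabilizers become subgroups of $S_k$; the conditions do not depend on the enumeration. $T_{ij}$ is the subgroup of $S_3$ generated by the transposition $(ij)$. $A_k$ is the alternating subgroup of $S_k$. $I_{ij,st}$ (where $\{i,j,s,t\}=\{1,2,3,4\}$) is the subgroup of $S_4$ of order 8 consisting of the permutations preserving the partition $\{\{i,j\},\{s,t\}\}$,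 i.e. generated by $(ij)$, $(st)$ and $(is)(jt)$; it contains the Klein four-group $V_4=\{1,(12)(34),(13)(24),(14)(23)\}$. *)

(* Defs.v *)
From HB Require Import structures.
From mathcomp Require Import all_boot all_order all_fingroup all_solvable.
From mathcomp Require Import finmap boolp.
Set Implicit Arguments.
Unset Strict Implicit.
Unset Printing Implicit Defensive.
Import Order.LTheory.

Declare Scope variety_scope.
Delimit Scope variety_scope with V.
Local Open Scope variety_scope.

Definition modular_element (d : Order.disp_t) (L : latticeType d) (x : L) : Prop :=
  forall y z : L, (y <= z)%O -> ((x `|` y) `&` z = (x `&` z) `|` y)%O.

(* The type of algebras is one associative binary operation together with
   unary operations indexed by [U]: plain semigroups are [ualg void], and
   semigroups with one unary operation are [ualg unit]. *)
Record ualg (U : Type) := Ualg {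
  carrier :> Type;
  mul : carrier -> carrier -> carrier;
  uop : U -> carrier -> carrier;
  ualg_inhabited : inhabited carrier;
  mulA : forall x y z, mul x (mul y z) = mul (mul x y) z }.

Arguments mul {U _}.
Arguments uop {U _}.
Arguments mulA {U _}.

Notation "x ** y" := (mul x y) (at level 40, left associativity) : variety_scope.

Definition is_hom (U : Type) (A B : ualg U) (f : A -> B) : Prop :=
  (forall x y, f (x ** y) = f x ** f y) /\ (forall o x, f (uop o x) = uop o (f x)).

Section Product.
Variables (U I : Type) (A : I -> ualg U).

Lemma prod_inhabited : inhabited (forall i, A i).
Proof.
have h i : exists _ : A i, True by have [a] := ualg_inhabited (A i); exists a.
by constructor=> i; exact: projT1 (cid (h i)).
Qed.

Lemma prod_mulA (x y z : forall i, A i) :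
  (fun i => x i ** (y i ** z i)) = (fun i => (x i ** y i) ** z i).
Proof. by apply: functional_extensionality_dep => i; exact: mulA. Qed.

Definition prod_ualg : ualg U :=
  @Ualg U (forall i, A i) (fun x y i => x i ** y i) (fun o x i => uop o (x i))
    prod_inhabited prod_mulA.
End Product.

Section IsVariety.
Variables (U : Type) (V : ualg U -> Prop).

Definition closed_image : Prop :=
  forall (A B : ualg U) (f : A -> B),
    is_hom f -> (forall b, exists a, f a = b) -> V A -> V B.

(* Up to isomorphism, the subalgebras of [B] are the algebras that embed in [B]. *)
Definition closed_sub : Prop :=
  forall (A B : ualg U) (f : A -> B), is_hom f -> injective f -> V B -> V A.

Definition closed_prod : Prop :=
  forall (I : Type) (A : I -> ualg U), (forall i, V (A i)) -> V (prod_ualg A).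

Definition is_variety : Prop := [/\ closed_image, closed_sub & closed_prod].
End IsVariety.

Record variety (U : Type) := Variety {
  variety_class :> ualg U -> Prop;
  varietyP : is_variety variety_class }.

Section VarietyLattice.
Variable U : Type.
Implicit Types V W X : variety U.

Lemma variety_inj V W : (forall S, V S <-> W S) -> V = W.
Proof.
case: V W => [V hV] [W hW] /= h.
have E : V = W by apply/funext => S; apply/propext.
by case: W / E hW {h} => hW; rewrite (Prop_irrelevance hV hW).
Qed.

HB.instance Definition _ := gen_eqMixin (variety U).
HB.instance Definition _ := gen_choiceMixin (variety U).

Definition variety_le V W : bool := `[< forall S, V S -> W S >].

Lemma variety_le_refl : reflexive variety_le.
Proof. by move=> V; apply/asboolP. Qed.

Lemma variety_le_anti : antisymmetric variety_le.
Proof.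
move=> V W /andP[/asboolP VW /asboolP WV].
by apply: variety_inj => S; split; [exact: VW | exact: WV].
Qed.

Lemma variety_le_trans : transitive variety_le.
Proof.
move=> W V X /asboolP VW /asboolP WX.
by apply/asboolP => S /VW /WX.
Qed.

Fact variety_display : Order.disp_t. Proof. exact: Order.Disp tt tt. Qed.

HB.instance Definition _ := @Order.Le_isPOrder.Build variety_display (variety U)
  variety_le variety_le_refl variety_le_anti variety_le_trans.

Lemma variety_meet_subproof V W : is_variety (fun S => V S /\ W S).
Proof.
have [Vh Vs Vp] := varietyP V; have [Wh Ws Wp] := varietyP W; split.
- by move=> A B f hf sf [/(Vh _ _ _ hf sf) ? /(Wh _ _ _ hf sf) ?].
- by move=> A B f hf jf [/(Vs _ _ _ hf jf) ? /(Ws _ _ _ hf jf) ?].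
- by move=> I A h; split; [apply: Vp | apply: Wp] => i; have [] := h i.
Qed.

Definition variety_meet V W : variety U := Variety (variety_meet_subproof V W).

Lemma variety_join_subproof V W : is_variety (fun S =>
  forall X, (forall A, V A -> X A) -> (forall A, W A -> X A) -> X S).
Proof.
split.
- move=> A B f hf sf h X VX WX; have [Xh _ _] := varietyP X.
  exact: Xh hf sf (h X VX WX).
- move=> A B f hf jf h X VX WX; have [_ Xs _] := varietyP X.
  exact: Xs hf jf (h X VX WX).
- move=> I A h X VX WX; have [_ _ Xp] := varietyP X.
  by apply: Xp => i; exact: h.
Qed.

Definition variety_join V W : variety U := Variety (variety_join_subproof V W).

Lemma variety_meetP V W X :
  (V <= variety_meet W X)%O = (V <= W)%O && (V <= X)%O.
Proof.
apply/asboolP/andP => [h|[/asboolP VW /asboolP VX] S VS].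
  by split; apply/asboolP => S /h[].
by split; [exact: VW | exact: VX].
Qed.

Lemma variety_joinP V W X :
  (variety_join V W <= X)%O = (V <= X)%O && (W <= X)%O.
Proof.
apply/asboolP/andP => [h|[/asboolP VX /asboolP WX] S]; last exact.
by split; apply/asboolP => S SV; apply: h => Y VY WY; [exact: VY | exact: WY].
Qed.

HB.instance Definition _ := @Order.POrder_MeetJoin_isLattice.Build
  variety_display (variety U) variety_meet variety_join
  variety_meetP variety_joinP.
End VarietyLattice.

Definition SEM := variety void.
HB.instance Definition _ := Order.Lattice.on SEM.

Section Powers.
Variables (U : Type) (S : ualg U).
Implicit Types (x y e : S) (G H : S -> Prop).

(* [pow x n] is x^(n+1), so that [pow] ranges over the positive powers. *)
Definition pow x n : S := iter n (mul x) x.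

Definition is_subgroup G e : Prop :=
  [/\ G e,
      forall x y, G x -> G y -> G (x ** y),
      forall x, G x -> e ** x = x /\ x ** e = x
    & forall x, G x -> exists y, [/\ G y, x ** y = e & y ** x = e]].

Definition maximal_subgroup G e : Prop :=
  is_subgroup G e /\
  forall H f, is_subgroup H f -> (forall x, G x -> H x) -> forall x, H x -> G x.

(* [y] is the inverse of [x ** e] in the maximal subgroup [G], with unit [e],
   containing some power of [x]. *)
Definition is_pseudoinverse x y : Prop :=
  exists G e n, [/\ maximal_subgroup G e, G (pow x n), G (x ** e) /\ G y,
                    (x ** e) ** y = e & y ** (x ** e) = e].
End Powers.

Definition is_epigroup (S : ualg unit) : Prop :=
  (forall x : S, exists G e n, is_subgroup G e /\ G (pow x n)) /\
  (forall x : S, is_pseudoinverse x (uop tt x)).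

Section Drazin.
Variables (U : Type) (S : ualg U).
Implicit Types (x y e : S).

(* Pseudoinversion in equational form, with a bound [n.+1] on the exponent of the
   first power of [x] lying in a subgroup.  A variety of epigroups has a uniform
   such bound, which is why joins of epigroup varieties are epigroup varieties. *)
Definition drazin n x y : Prop :=
  [/\ x ** y = y ** x, y ** x ** y = y & pow x n.+1 ** y = pow x n].

Lemma powSr x n : pow x n.+1 = pow x n ** x.
Proof.
elim: n => [//|n IHn]; rewrite -[LHS]/(x ** pow x n.+1) {1}IHn mulA.
by rewrite -[_ ** pow x n]/(pow x n.+1).
Qed.

Lemma drazinS n x y : drazin n x y -> drazin n.+1 x y.
Proof.
case=> c i p; split=> //.
by rewrite -[pow x n.+2]/(x ** pow x n.+1) -mulA p.
Qed.

Lemma drazinW m n x y : m <= n -> drazin m x y -> drazin n x y.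
Proof.
by move=> /subnK <- h; elim: (n - m) => [//|k IHk]; exact: drazinS.
Qed.

Lemma pseudoinverse_drazin x y : is_pseudoinverse x y -> exists n, drazin n x y.
Proof.
case=> G [e [n [[[Ge GM G1 GV] _] Gx [Gxe Gy] xy yx]]].
exists n.
have [g [Gg xg gx]] := GV _ Gx.
have xX : pow x n ** x = x ** pow x n by rewrite -powSr.
have exe : e ** (x ** e) = x ** e by have [] := G1 _ Gxe.
have ex : e ** x = x ** e.
  have [_ Xe] := G1 _ Gx.
  by rewrite -[RHS]exe -{1}gx -mulA xX -{1}Xe (mulA x) -xX -mulA mulA gx.
have [ey ye] := G1 _ Gy.
have xyE : x ** y = e by rewrite -{1}ey mulA.
have yxE : y ** x = e by rewrite -{1}ye -mulA ex.
split; first by rewrite xyE.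
  by rewrite yxE.
by rewrite powSr -mulA xyE; have [] := G1 _ Gx.
Qed.

Lemma pow_comm x y n : x ** y = y ** x -> pow x n ** y = y ** pow x n.
Proof.
by move=> c; elim: n => [//|n IHn]; rewrite /= -mulA IHn mulA c -mulA.
Qed.

Lemma drazin_pseudoinverse n x y : drazin n x y -> is_pseudoinverse x y.
Proof.
case=> c i p.
have [e eE] : exists e, e = x ** y by exists (x ** y).
have ee : e ** e = e by rewrite eE -mulA [y ** _]mulA i.
pose G a := [/\ e ** a = a, a ** e = a &
  exists b, [/\ e ** b = b, b ** e = b, a ** b = e & b ** a = e]].
have Gsub : is_subgroup G e.
  split.
  - by split=> //; exists e.
  - move=> a b [ea ae [a' [ea' a'e aa' a'a]]] [eb be [b' [eb' b'e bb' b'b]]].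
    split; [by rewrite mulA ea | by rewrite -mulA be |].
    exists (b' ** a'); split.
    + by rewrite mulA eb'.
    + by rewrite -mulA a'e.
    + by rewrite mulA -[_ ** b']mulA bb' ae.
    + by rewrite mulA -[_ ** a]mulA a'a b'e.
  - by move=> a [].
  - move=> a [ea ae [b [eb be ab ba]]]; exists b; split=> //.
    by split=> //; exists a.
have ey : e ** y = y by rewrite eE c i.
have ye : y ** e = y by rewrite eE mulA i.
have ex : e ** x = x ** e by rewrite eE [in RHS]c mulA.
have exe : e ** (x ** e) = x ** e by rewrite -ex mulA ee.
have Gxe : G (x ** e).
  split=> //; first by rewrite -mulA ee.
  exists y; split=> //; first by rewrite -mulA ey.
  by rewrite -ex mulA ye -c.
have Gy : G y.
  split=> //; exists (x ** e); split=> //.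
  - by rewrite -mulA ee.
  - by rewrite -ex mulA ye -c.
  - by rewrite -mulA ey.
have xe m : G (pow x m ** e).
  have [_ GM _ _] := Gsub.
  elim: m => [//|m IHm].
  have -> : pow x m.+1 ** e = pow x m ** e ** (x ** e).
    by rewrite powSr -!mulA exe.
  exact: GM.
have pe : pow x n ** e = pow x n by rewrite eE mulA -powSr.
exists G, e, n; split=> //.
- split=> // H f [Hf HM H1 HV] GH a Ha.
  have He : H e by apply: GH; case: Gsub.
  have fe : e = f.
    have [g [_ eg _]] := HV _ He.
    by have [_ ef] := H1 _ He; rewrite -[LHS]ef -[in LHS]eg mulA ee.
  rewrite -fe in H1 HV.
  have [ea ae] := H1 _ Ha; have [b [Hb ab ba]] := HV _ Ha.
  have [eb be] := H1 _ Hb.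
  by split=> //; exists b.
- by rewrite -pe.
- by rewrite -mulA ey.
- by rewrite -ex mulA ye -c.
Qed.
End Drazin.

Lemma hom_pow (U : Type) (A B : ualg U) (f : A -> B) x n :
  is_hom f -> f (pow x n) = pow (f x) n.
Proof. by case=> fM _; elim: n => [//|n IHn]; rewrite /= fM IHn. Qed.

Lemma hom_proj (U I : Type) (A : I -> ualg U) (i : I) :
  is_hom (fun x : prod_ualg A => x i).
Proof. by []. Qed.

Section EpigroupVarieties.
Implicit Types (S : ualg unit) (V W : variety unit).

Definition drazin_class n S : Prop := forall x : S, drazin n x (uop tt x).

Lemma drazin_class_variety n : is_variety (drazin_class n).
Proof.
split.
- move=> A B f hf sf hA b; have [a <-] := sf b; have [fM fU] := hf.
  have [c i p] := hA a.
  by split; rewrite -fU -?hom_pow // -!fM ?c ?i ?p.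
- move=> A B f hf jf hB a; have [fM fU] := hf; have [c i p] := hB (f a).
  split; apply: jf; [by rewrite !fM fU | by rewrite !fM fU |].
  by rewrite fM !(hom_pow _ _ hf) fU.
- move=> I A h x.
  split; apply: functional_extensionality_dep => i;
    have [c j p] := h i (x i); [exact: c | exact: j |].
  rewrite -[LHS]/((pow x n.+1) i ** uop tt (x i)).
  by rewrite (hom_pow x n.+1 (hom_proj A i)) (hom_pow x n (hom_proj A i)).
Qed.

Lemma drazin_class_epigroup n S : drazin_class n S -> is_epigroup S.
Proof.
move=> h; split=> x; last exact: drazin_pseudoinverse (h x).
have [G [e [m [[Gs _] Gx _ _ _]]]] := drazin_pseudoinverse (h x).
by exists G, e, m.
Qed.

Definition epigroup_variety : pred (variety unit) :=
  fun V => `[< forall S, V S -> is_epigroup S >].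

Lemma epigroup_variety_index V : epigroup_variety V ->
  exists n, forall S, V S -> drazin_class n S.
Proof.
move=> /asboolP VE; apply: contrapT => /forallNP nV.
have {nV} nV n : exists p : {S : ualg unit & S},
    V (projT1 p) /\ ~ drazin n (projT2 p) (uop tt (projT2 p)).
  have /existsNP[S /not_implyP[VS /existsNP[x nx]]] := nV n.
  by exists (existT _ S x).
have [p hp] := choice nV.
pose P := prod_ualg (fun n => projT1 (p n)).
have VP : V P by have [_ _ Vp] := varietyP V; apply: Vp => n; case: (hp n).
pose x : P := fun n => projT2 (p n).
have [_ /(_ x) /pseudoinverse_drazin[n [c i q]]] := VE _ VP.
case: (hp n) => _; apply; split.
- exact: (congr1 (fun z : P => z n) c).
- exact: (congr1 (fun z : P => z n) i).
- have := congr1 (fun z : P => z n) q.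
  rewrite (hom_proj (fun n => projT1 (p n)) n).1 (hom_pow x n.+1 (hom_proj (fun n => projT1 (p n)) n)).
  by rewrite (hom_pow x n (hom_proj (fun n => projT1 (p n)) n)).
Qed.

Lemma epigroup_variety_meet :
  {in epigroup_variety &, forall V W, (V `&` W)%O \in epigroup_variety}.
Proof.
move=> V W /asboolP VE _; apply/asboolP => S [VS _]; exact: VE.
Qed.

Lemma epigroup_variety_join :
  {in epigroup_variety &, forall V W, (V `|` W)%O \in epigroup_variety}.
Proof.
move=> V W /epigroup_variety_index[m Vm] /epigroup_variety_index[n Wn].
apply/asboolP => S hS; apply: (@drazin_class_epigroup (maxn m n)).
apply: (hS (Variety (drazin_class_variety (maxn m n)))) => A hA x.
- by apply: drazinW (Vm _ hA x); exact: leq_maxl.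
- by apply: drazinW (Wn _ hA x); exact: leq_maxr.
Qed.
End EpigroupVarieties.

Record EPI := Epi {
  epi_variety :> variety unit;
  epi_varietyP : epigroup_variety epi_variety }.

Fact epi_display : Order.disp_t. Proof. exact: Order.Disp tt tt. Qed.

HB.instance Definition _ := [isSub for epi_variety].
HB.instance Definition _ := [Choice of EPI by <:].
HB.instance Definition _ :=
  @Order.SubChoice_isSubLattice.Build variety_display (variety unit)
    epigroup_variety epi_display EPI epigroup_variety_meet epigroup_variety_join.

Section TrivialSemilattice.
Variable U : Type.
Implicit Type S : ualg U.

Definition is_trivial S : Prop := forall x y : S, x = y.

Definition is_semilattice S : Prop :=
  (forall x : S, x ** x = x) /\ (forall x y : S, x ** y = y ** x).

Lemma trivial_variety : is_variety is_trivial.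
Proof.
split.
- move=> A B f _ sf hA b b'; have [a <-] := sf b; have [a' <-] := sf b'.
  by rewrite (hA a a').
- by move=> A B f _ jf hB a a'; apply: jf.
- by move=> I A h x y; apply: functional_extensionality_dep => i; exact: h.
Qed.

Lemma semilattice_image (A B : ualg U) (f : A -> B) :
  is_hom f -> (forall b, exists a, f a = b) -> is_semilattice A -> is_semilattice B.
Proof.
move=> [fM _] sf [ii cc]; split=> [b|b b']; have [a <-] := sf b.
  by rewrite -fM ii.
by have [a' <-] := sf b'; rewrite -!fM cc.
Qed.

Lemma semilattice_sub (A B : ualg U) (f : A -> B) :
  is_hom f -> injective f -> is_semilattice B -> is_semilattice A.
Proof.
move=> [fM _] jf [ii cc].
by split=> [a|a a']; apply: jf; rewrite !fM; [exact: ii | exact: cc].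
Qed.

Lemma semilattice_prod (I : Type) (A : I -> ualg U) :
  (forall i, is_semilattice (A i)) -> is_semilattice (prod_ualg A).
Proof.
by move=> h; split=> [x|x y]; apply: functional_extensionality_dep => i;
  have [ii cc] := h i; [exact: ii | exact: cc].
Qed.
End TrivialSemilattice.

Definition SEM_T : SEM := Variety (@trivial_variety void).

Lemma SEM_SL_subproof : is_variety (@is_semilattice void).
Proof.
by split; [exact: semilattice_image | exact: semilattice_sub
          | exact: semilattice_prod].
Qed.

Definition SEM_SL : SEM := Variety SEM_SL_subproof.

Lemma EPI_T_subproof : epigroup_variety (Variety (@trivial_variety unit)).
Proof.
apply/asboolP => S tS; apply: (@drazin_class_epigroup 0) => x.
by split; exact: tS.
Qed.

Definition EPI_T : EPI := Epi EPI_T_subproof.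

Lemma semilattice_drazin (S : ualg unit) :
  is_semilattice S -> (is_epigroup S <-> drazin_class 0 S).
Proof.
move=> [ii cc]; split; last exact: drazin_class_epigroup.
move=> [_ hS] x; have /pseudoinverse_drazin[n [c i p]] := hS x.
have px k : pow x k = x by elim: k => [//|k IHk]; rewrite /= IHk ii.
by rewrite !px in p; split=> //; rewrite !px.
Qed.

Lemma EPI_SL_variety : is_variety (fun S => is_epigroup S /\ is_semilattice S).
Proof.
have [Dh Ds Dp] := drazin_class_variety 0; split.
- move=> A B f hf sf [eA sA].
  have sB := semilattice_image hf sf sA; split=> //.
  by apply/(semilattice_drazin sB)/(Dh _ _ _ hf sf)/(semilattice_drazin sA).
- move=> A B f hf jf [eB sB].
  have sA := semilattice_sub hf jf sB; split=> //.
  by apply/(semilattice_drazin sA)/(Ds _ _ _ hf jf)/(semilattice_drazin sB).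
- move=> I A h.
  have sP : is_semilattice (prod_ualg A).
    by apply: semilattice_prod => i; case: (h i).
  split=> //; apply/(semilattice_drazin sP)/Dp => i.
  by have [eA sA] := h i; apply/(semilattice_drazin sA).
Qed.

Lemma EPI_SL_subproof : epigroup_variety (Variety EPI_SL_variety).
Proof. by apply/asboolP => S []. Qed.

Definition EPI_SL : EPI := Epi EPI_SL_subproof.

Definition is_nilsemigroup (U : Type) (S : ualg U) : Prop :=
  exists z : S, (forall x, z ** x = z /\ x ** z = z) /\
                forall x, exists n, pow x n = z.

Definition nil_variety (U : Type) (V : variety U) : Prop :=
  forall S, V S -> is_nilsemigroup S.

(* The free semigroup F over the letters [nat]: nonempty sequences. *)
Record word := Word { whead : nat; wtail : seq nat }.

Definition letters (w : word) : seq nat := whead w :: wtail w.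
Coercion letters : word >-> seq.

Definition wcat (u v : word) : word := Word (whead u) (wtail u ++ v).

Definition wletter (x : nat) : word := Word x [::].

Definition wrename (f : nat -> nat) (w : word) : word :=
  Word (f (whead w)) (map f (wtail w)).

Definition weval (U : Type) (S : ualg U) (f : nat -> S) (w : word) : S :=
  foldl (fun a x => a ** f x) (f (whead w)) (wtail w).

Definition alph (w : word) : {fset nat} := [fset x in letters w]%fset.

Definition is_endo (xi : word -> word) : Prop :=
  forall u v, xi (wcat u v) = wcat (xi u) (xi v).

Definition word_le (u v : word) : Prop :=
  exists2 xi, is_endo xi &
    exists a b : seq nat, letters v = a ++ letters (xi u) ++ b.

Definition word_equiv (u v : word) : Prop := word_le u v /\ word_le v u.

Section LetterPerm.
Variables (X : finType) (e : X -> nat).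

(* The action on letters of a permutation of [X], when [X] is identified with
   a set of letters through the injection [e]; other letters are fixed. *)
Definition letter_perm (s : {perm X}) (x : nat) : nat :=
  if [pick i | e i == x] is Some i then e (s i) else x.

Definition word_perm (s : {perm X}) (w : word) : word :=
  wrename (letter_perm s) w.
End LetterPerm.

Definition substitutive (u v : word) : Prop :=
  alph u = alph v /\
  exists s : {perm alph u}, v = word_perm val s u.

Section Identities.
Variables (U : Type) (N : variety U).
Implicit Types u v w : word.

(* Identities between semigroup words, also when [U] is not empty. *)
Definition satisfies u v : Prop :=
  forall S, N S -> forall f : nat -> S, weval f u = weval f v.

Definition satisfies0 w : Prop :=
  forall x : nat, x \notin alph w ->
    satisfies (wcat w (wletter x)) (wcat (wletter x) w) /\
    satisfies (wcat (wletter x) w) w.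

(* Stab_N(u), as a set of permutations of [X], when alph(u) is identified with
   [X] through the injection [e]. *)
Definition stab_on (X : finType) (e : X -> nat) u : {set {perm X}} :=
  [set s | `[< satisfies u (word_perm e s u) >]].

Lemma weval_rename (S : ualg U) (f : nat -> S) g w :
  weval f (wrename g w) = weval (f \o g) w.
Proof.
rewrite /weval /=; case: w => x s /=.
by elim: s (f (g x)) => [//|y s IHs] a /=.
Qed.

Lemma eq_weval (S : ualg U) (f g : nat -> S) w : f =1 g -> weval f w = weval g w.
Proof.
move=> fg; rewrite /weval fg.
by elim: (wtail w) (g _) => [//|y s IHs] a /=; rewrite fg IHs.
Qed.

Lemma eq_wrename f g w : {in letters w, f =1 g} -> wrename f w = wrename g w.
Proof.
case: w => x s /= h; rewrite /wrename /= h ?inE ?eqxx //; congr Word.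
by apply/eq_in_map => y ys; apply: h; rewrite inE ys orbT.
Qed.

Lemma letter_permE (X : finType) (e : X -> nat) s i :
  injective e -> letter_perm e s (e i) = e (s i).
Proof.
move=> je; rewrite /letter_perm; case: pickP => [j /eqP/je -> //|/(_ i)].
by rewrite eqxx.
Qed.

Lemma stab_on_group_set (X : finType) (e : X -> nat) u :
  injective e -> group_set (stab_on e u).
Proof.
move=> je; apply/group_setP; split.
  rewrite inE; apply/asboolP => S _ f; rewrite weval_rename.
  apply: eq_weval => x /=; congr f; rewrite /letter_perm.
  by case: pickP => [i /eqP <-|//]; rewrite perm1.
move=> s t; rewrite !inE => /asboolP us /asboolP ut.
apply/asboolP => S NS f.
rewrite (ut S NS f) /word_perm weval_rename (us S NS) !weval_rename.
apply: eq_weval => x /=; congr f; rewrite /letter_perm.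
case: (pickP (fun i => e i == x)) => [i _|nx]; last first.
  by case: pickP => [i|//]; rewrite nx.
by rewrite -/(letter_perm e t (e (s i))) letter_permE // permM.
Qed.

Definition stab u : {set {perm alph u}} := stab_on val u.

Canonical stab_group u : {group {perm alph u}} :=
  Group (stab_on_group_set u (@val_inj _ _ (alph u))).
End Identities.

Definition Sub (gT : finGroupType) := {group gT}.

Section SubLattice.
Variable gT : finGroupType.
Implicit Types G H K : Sub gT.

Definition sub_le G H : bool := G \subset H.

Lemma sub_le_refl : reflexive sub_le.
Proof. by move=> G; exact: subxx. Qed.

Lemma sub_le_anti : antisymmetric sub_le.
Proof. by move=> G H GH; apply/val_inj/eqP; rewrite eqEsubset. Qed.

Lemma sub_le_trans : transitive sub_le.
Proof. by move=> H G K; exact: subset_trans. Qed.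

Fact sub_display : Order.disp_t. Proof. exact: Order.Disp tt tt. Qed.

HB.instance Definition _ := Choice.on (Sub gT).
HB.instance Definition _ := @Order.Le_isPOrder.Build sub_display (Sub gT)
  sub_le sub_le_refl sub_le_anti sub_le_trans.

Definition sub_meet G H : Sub gT := (G :&: H)%G.
Definition sub_join G H : Sub gT := (G <*> H)%G.

Lemma sub_meetP G H K : (G <= sub_meet H K)%O = (G <= H)%O && (G <= K)%O.
Proof. exact: subsetI. Qed.

Lemma sub_joinP G H K : (sub_join G H <= K)%O = (G <= K)%O && (H <= K)%O.
Proof. exact: join_subG. Qed.

HB.instance Definition _ := @Order.POrder_MeetJoin_isLattice.Build
  sub_display (Sub gT) sub_meet sub_join sub_meetP sub_joinP.
End SubLattice.

(* The points 1, ..., k on which S_k acts are 0, ..., k-1 here. *)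
Definition T3 (i j : nat) : {set 'S_3} := <[tperm (inord i) (inord j)]>%g.

Definition T3s : {set {set 'S_3}} := [set T3 0 1; T3 1 2; T3 0 2].

Definition I4 (i j s t : nat) : {set 'S_4} :=
  let o k : 'I_4 := inord k in
  <<[set tperm (o i) (o j); tperm (o s) (o t);
         tperm (o i) (o s) * tperm (o j) (o t)]>>%g.

Definition I4s : {set {set 'S_4}} := [set I4 0 1 2 3; I4 0 2 1 3; I4 0 3 1 2].

Definition enumerates (k : nat) (e : 'I_k -> nat) (A : {fset nat}) : Prop :=
  injective e /\ forall x, (x \in A) = (x \in codom e).

Section Conditions.
Variables (U : Type) (N : variety U).

Definition cond_a : Prop :=
  forall u v : word, ~ substitutive u v -> satisfies N u v ->
    satisfies0 N u /\ satisfies0 N v.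

Definition cond_b : Prop :=
  forall u : word, ~ satisfies0 N u ->
    modular_element (stab_group N u : Sub {perm alph u}).

(* [e] identifies 1, ..., k with the letters; the same [e] serves [u] and [v],
   and whether the condition holds does not depend on its choice. *)
Definition stabs_in (k : nat) (P Q : {set {set 'S_k}}) (u v : word) : Prop :=
  exists e : 'I_k -> nat,
    [/\ enumerates e (alph u), stab_on N e u \in P & stab_on N e v \in Q].

Definition cond_c' : Prop :=
  ~ exists u v : word,
      [/\ ~ word_equiv u v, alph u = alph v &
          [\/ stabs_in T3s T3s u v,
              stabs_in T3s [set ('Alt_('I_3))%g] u v,
              stabs_in I4s I4s u v
            | stabs_in I4s [set ('Alt_('I_4))%g] u v]].
End Conditions.

(* Main.v *)
Require Import Defs.
From mathcomp Require Import all_boot all_order all_fingroup all_solvable.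
From mathcomp Require Import finmap boolp zify.
From Stdlib Require Import Relation_Operators.
Set Implicit Arguments.
Unset Strict Implicit.
Unset Printing Implicit Defensive.
Import Order.LTheory.

(* By Birkhoff's theorem it is enough to argue with identities.  Let x, y, z be
   the fully invariant congruences of V = M v N, Y, Z with Y <= Z, so that z is
   contained in y, and let s y t with s and t joined by a chain of x- and
   z-steps.  The chain has to be replaced by one of z-steps and of x-steps that
   are also y-steps.

   If some term of the chain is z-equal to a term that is zero in N, then all
   are, and one may take s and t to be zero in N.  Then s x t unless M = SL and
   the letters of s and t differ; in that case y lets s absorb a term on which z
   changes the letters, so that s and t are both linked to terms having all the
   letters of s and t.

   Otherwise all terms of the chain are words with the same k letters, and by
   condition (a) an x-step renames the letters of a word w by an element of
   Stab_N(w).  So t is z-equal to s^g for some g in the subgroup generated by the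
   Stab_N(w) for w z s.  Among these stabilizers let H be one of maximal order.
   If w is equivalent to the word of H, then Stab_N(w) is conjugate to H by an
   element of K = Stab_Z(s); if not, then by (c') and the description of the
   modular subgroups of S_k, Stab_N(w) is comparable with H, hence contained in
   it.  Thus g lies in H v K and in J = Stab_Y(s), where K <= J, and modularity of
   H gives g in (H ^ J) v K, which is what is needed. *)

(** * Modular subgroups of symmetric groups *)

Local Open Scope group_scope.

(** In a finite group inverses are positive powers, so generated elements are plain products and an
    induction on their length suffices. The set [E] is not assumed to be a subgroup. *)
Lemma gen_lmul_subset (gT : finGroupType) (A E : {set gT}) :
  1 \in E -> {in A & E, forall a x, a * x \in E} -> <<A>> \subset E.
Proof.
move=> E1 EA; apply/subsetP => x /gen_prodgP[n [c Ac ->]].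
elim: n c Ac => [|n IHn] c Ac; first by rewrite big_ord0.
by rewrite big_ord_recl EA // IHn // => i; apply: Ac.
Qed.

(** Only the nontrivial half of the modular law; the reverse inclusion always holds. *)
Definition modular_subgroup (gT : finGroupType) (H : {group gT}) : Prop :=
  forall Y Z : {group gT}, Y \subset Z ->
    (H <*> Y) :&: Z \subset (H :&: Z) <*> Y.

Lemma modular_subgroupP (gT : finGroupType) (H : Defs.Sub gT) :
  modular_element H -> modular_subgroup H.
Proof. by move=> hH Y Z YZ; have /(congr1 val)/= <- := hH Y Z YZ. Qed.

(** * Modularity tested on an involution and its conjugate *)

Section Involutions.
Variables (gT : finGroupType) (H : {group gT}).
Hypothesis modH : modular_subgroup H.
Implicit Types a b h : gT.

(* [a ^ h] lies in the join of [H] and [<[a]>], so by modularity [H] cannot meet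
   [<<[set a; a ^ h]>>] trivially. *)
Lemma modular_involution_meet a h : a * a = 1 -> h \in H -> a ^ h != a ->
  exists2 z, z \in H :&: <<[set a; a ^ h]>> & z != 1.
Proof.
move=> aa hH nab; apply/exists_inP; rewrite -negb_forall_in.
apply: contraNN nab => /forall_inP triv.
have /(_ _)/subsetP := @modH <[a]>%G <<[set a; a ^ h]>>%G.
have -> : H :&: <<[set a; a ^ h]>> = 1.
  by apply/trivgP/subsetP => z /triv; rewrite inE.
rewrite /= joing1G => /(_ _ (a ^ h)).
have -> : <[a]> \subset <<[set a; a ^ h]>>.
  by rewrite cycle_subG mem_gen // !inE eqxx.
have aHa : a ^ h \in H <*> <[a]>.
  have Hs : h \in H <*> <[a]> by apply: (subsetP (joing_subl _ _)).
  by apply: groupJ => //; apply: (subsetP (joing_subr _ _)); exact: cycle_id.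
rewrite inE aHa mem_gen ?inE ?eqxx ?orbT // => /(_ isT isT).
have /subsetP : <<[set a]>> \subset [set 1; a].
  apply: gen_lmul_subset; first by rewrite !inE eqxx.
  by move=> x y; rewrite !inE => /eqP -> /orP[] /eqP ->; rewrite ?mulg1 ?aa eqxx ?orbT.
move=> sub2 /sub2; rewrite !inE => /orP[/eqP/(congr1 (fun x => x ^ h^-1))|//].
by rewrite conjgK conj1g => ->; rewrite conj1g.
Qed.

(** With [b = a ^ h], the group generated by [a] and [b] is {1, a, b, ab}, and [H] contains a
    nontrivial element of it; [b] is in [H] exactly when [a] is, as [h] is in [H]. *)
Lemma modular_commuting_involution a h : a * a = 1 -> h \in H ->
  a * a ^ h = a ^ h * a -> a \in H \/ a * a ^ h \in H.
Proof.
move=> aa hH cab; have [ab|nab] := eqVneq (a ^ h) a.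
  by right; rewrite ab aa group1.
have [z zHZ z1] := modular_involution_meet aa hH nab.
have [E bb] : a ^ h \in H = (a \in H) /\ a ^ h * a ^ h = 1.
  by rewrite groupJr // -conjMg aa conj1g.
move: (a ^ h) cab zHZ E bb => b ab /setIP[zH zZ] E bb {nab}.
have /subsetP/(_ z zZ) : <<[set a; b]>> \subset [set 1; a; b; a * b].
  apply: gen_lmul_subset; first by rewrite !inE eqxx.
  move=> x y; rewrite !inE => /orP[]/eqP -> /orP[/orP[/orP[]|]|]/eqP->.
  - by rewrite mulg1 eqxx ?orbT.
  - by rewrite aa eqxx.
  - by rewrite eqxx !orbT.
  - by rewrite mulgA aa mul1g eqxx !orbT.
  - by rewrite mulg1 eqxx ?orbT.
  - by rewrite ab eqxx ?orbT.
  - by rewrite bb eqxx ?orbT.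
  - by rewrite ab mulgA bb mul1g eqxx ?orbT.
rewrite !inE (negPf z1) /= => /orP[/orP[]|] /eqP zE; rewrite -zE; auto.
by left; rewrite -E -zE.
Qed.

(** Here [a] and [b = a ^ h] generate {1, a, b, ab, ba, bab}, a quotient of the dihedral group of
    order 6, and [ba] is the inverse of [ab]. *)
Lemma modular_braid_involution a h : a * a = 1 -> h \in H ->
  a * a ^ h * a = a ^ h * a * a ^ h ->
  [\/ a \in H, a * a ^ h \in H | a ^ h * a * a ^ h \in H].
Proof.
move=> aa hH cab; have [ab|nab] := eqVneq (a ^ h) a.
  by constructor 2; rewrite ab aa group1.
have [z zHZ z1] := modular_involution_meet aa hH nab.
have [E bb] : a ^ h \in H = (a \in H) /\ a ^ h * a ^ h = 1.
  by rewrite groupJr // -conjMg aa conj1g.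
move: (a ^ h) cab zHZ E bb => b ab /setIP[zH zZ] E bb {nab}.
have /subsetP/(_ z zZ) :
    <<[set a; b]>> \subset [set 1; a; b; a * b; b * a; b * a * b].
  apply: gen_lmul_subset; first by rewrite !inE eqxx.
  move=> x y; rewrite !inE => /orP[]/eqP -> /orP[/orP[/orP[/orP[/orP[]|]|]|]|]/eqP->.
  - by rewrite mulg1 eqxx ?orbT.
  - by rewrite aa eqxx.
  - by rewrite eqxx !orbT.
  - by rewrite mulgA aa mul1g eqxx !orbT.
  - by rewrite mulgA ab eqxx !orbT.
  - by rewrite -ab !mulgA aa mul1g eqxx !orbT.
  - by rewrite mulg1 eqxx ?orbT.
  - by rewrite eqxx ?orbT.
  - by rewrite bb eqxx ?orbT.
  - by rewrite mulgA eqxx ?orbT.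
  - by rewrite mulgA bb mul1g eqxx ?orbT.
  - by rewrite !mulgA bb mul1g eqxx ?orbT.
have abV : (b * a)^-1 = a * b.
  by apply/eqP; rewrite eq_invg_mul !mulgA -(mulgA b) aa mulg1 bb.
rewrite !inE (negPf z1) /= => /orP[/orP[/orP[/orP[]|]|]|] /eqP zE.
- by constructor 1; rewrite -zE.
- by constructor 1; rewrite -E -zE.
- by constructor 2; rewrite -zE.
- by constructor 2; rewrite -abV groupV -zE.
- by constructor 3; rewrite -zE.
Qed.

End Involutions.

(** Equal or disjoint transpositions commute; if they share exactly one point, each conjugates the
    other to the same third one, which is the braid relation. *)
Lemma tperm_commute_or_braid (T : finType) (i j k l : T) :
  let a := tperm i j in let b := tperm k l in
  a * b = b * a \/ a * b * a = b * a * b.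
Proof.
move=> a b.
have com : b ^ a = b -> a * b = b * a \/ a * b * a = b * a * b.
  by move=> e; left; rewrite [b * a]conjgC e.
have bra : b ^ a = a ^ b -> a * b = b * a \/ a * b * a = b * a * b.
  by rewrite !conjgE !tpermV !mulgA => ->; right.
case: (eqVneq i j) => [e|ij].
  by left; rewrite /a e tperm1 mulg1 mul1g.
case: (eqVneq k l) => [e|kl].
  by left; rewrite /b e tperm1 mulg1 mul1g.
have share x y z : x != y -> x != z -> y != z ->
    tperm x y ^ tperm x z = tperm x z ^ tperm x y.
  by move=> xy xz yz; rewrite !tpermJ_tperm // 1?eq_sym // tpermC.
case: (eqVneq i k) => [e|ik].
  subst k; case: (eqVneq j l) => [e|jl]; first by subst l; left.
  by apply: bra; rewrite share // eq_sym.
case: (eqVneq i l) => [e|il].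
  subst l; case: (eqVneq j k) => [e|jk]; first by left; subst k; rewrite /a /b tpermC.
  by apply: bra; rewrite /a /b (tpermC k) share // eq_sym.
case: (eqVneq j k) => [e|jk].
  by subst k; apply: bra; rewrite /a /b (tpermC i) share // eq_sym.
case: (eqVneq j l) => [e|jl].
  by subst l; apply: bra; rewrite /a /b (tpermC i) (tpermC k) share // eq_sym.
by apply: com; rewrite /a /b tpermJ !tpermD.
Qed.

Lemma all_tperm_setT (T : finType) (H : {group {perm T}}) :
  (forall i j, tperm i j \in H) -> H = [set: {perm T}]%G.
Proof.
move=> hH; apply/val_inj/setP => s; rewrite /= inE.
have [ts -> _] := prod_tpermP s.
by rewrite group_prod // => t _; exact: hH.
Qed.

(** On four points these are the nontrivial elements of the Klein four-group. *)
Definition fixfree_involution (T : finType) (h : {perm T}) : Prop :=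
  (forall x, h x != x) /\ (forall x, h (h x) = x).

(** * Modular subgroups without transpositions *)

Section NoTransposition.
Variables (T : finType) (H : {group {perm T}}).
Hypothesis modH : modular_subgroup H.
Hypothesis no_tperm : forall i j : T, i != j -> tperm i j \notin H.
Implicit Types (i j k l m x : T) (s h : {perm T}).

(** The other alternatives for [a = (i j)] would put a transposition into [H]: either [a] itself or
    a conjugate of [a]. *)
Lemma tperm_comm_in i j h : h \in H -> tperm i j * tperm (h i) (h j) \in H.
Proof.
move=> hH; have [<-|ij] := eqVneq i j; first by rewrite !tperm1 mulg1 group1.
have nt := no_tperm ij.
rewrite -tpermJ; have := tperm_commute_or_braid i j (h i) (h j).
rewrite -tpermJ => -[c|b].
  case: (modular_commuting_involution modH (tperm2 i j) hH c) => //.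
  by rewrite (negPf nt).
case: (modular_braid_involution modH (tperm2 i j) hH b) => //.
  by rewrite (negPf nt).
rewrite -mulgA -{1}[_ ^ h](invgK (tperm i j ^ h)) -conjVg tpermV -conjgE.
rewrite (tpermJ i j (_ ^ h)) (negPf (no_tperm _)) //.
by rewrite (inj_eq perm_inj).
Qed.

(** For a transposition [t], [tperm_comm_in] applied to the inverse of [h] puts [t h t h^-1], hence
    [t h t], into [H]; transpositions generate the symmetric group. *)
Lemma no_tperm_normal s h : h \in H -> h ^ s \in H.
Proof.
have [ts -> _] := prod_tpermP s; elim: ts h => [|t ts IHts] h hH.
  by rewrite big_nil conjg1.
rewrite big_cons conjgM; apply: IHts; rewrite conjgE tpermV.
have := tperm_comm_in t.1 t.2 (groupVr hH).
by rewrite -tpermJ conjgE invgK !mulgA groupMr ?groupVr.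
Qed.

Local Notation R i j k l := (tperm i j * tperm k l \in H).

Lemma tperm_prod_perm s i j k l : R i j k l -> R (s i) (s j) (s k) (s l).
Proof. by rewrite -(tpermJ i) -(tpermJ k) -conjMg => /(no_tperm_normal s). Qed.

Lemma tperm_prod_trans i j k l i' j' : R i j k l -> R k l i' j' -> R i j i' j'.
Proof.
move=> h1 h2; have := groupM h1 h2.
by rewrite !mulgA -(mulgA (tperm i j)) tperm2 mulg1.
Qed.

(** The product [(i j)(j k)] is a 3-cycle. By normality and transitivity of [R], all products of two
    transpositions follow, hence all even permutations; an odd one would bring [(i j)] along. *)
Lemma three_cycle_Alt i j k :
  i != j -> i != k -> j != k -> R i j j k -> H = 'Alt_T%G.
Proof.
move=> ij ik jk h.
have P0 l : l != i -> l != j -> R i j i l.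
  move=> li lj; rewrite (tpermC i j).
  have := tperm_prod_perm (tperm k l) h.
  have D x : k != x -> l != x -> tperm k l x = x by exact: tpermD.
  rewrite tpermL !D 1?[k == _]eq_sym // => /(tperm_prod_perm (tperm i j)).
  by rewrite tpermL tpermR [tperm i j l]tpermD // eq_sym.
have P x y l : x != y -> l != x -> l != y -> R x y x l.
  move=> xy lx ly.
  (* This [s] sends [i] to [x] and [j] to [y], which carries [P0] over to arbitrary points. *)
  pose s := tperm i x * tperm (tperm i x j) y.
  have nx : x != tperm i x j.
    by rewrite -{1}(tpermL i x) (inj_eq perm_inj).
  have sx : s i = x by rewrite permM tpermL tpermD // eq_sym.
  have sy : s j = y by rewrite permM tpermL.
  have := @P0 (s^-1 l); rewrite -{1}sx -{1}sy.
  rewrite -(inj_eq (@perm_inj _ s)) permKV sx lx => /(_ isT).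
  rewrite -(inj_eq (@perm_inj _ s)) permKV sy ly => /(_ isT)/(tperm_prod_perm s).
  by rewrite permKV sx sy.
have Q x y z t : x != y -> z != t -> R x y z t.
  have Q1 a b c : a != b -> c != a -> R a b a c.
    move=> ab ca; have [->|cb] := eqVneq c b; first by rewrite tperm2 group1.
    exact: P.
  move=> xy zt; have [zx|zx] := eqVneq z x.
    by subst z; apply: Q1; rewrite // eq_sym.
  have [tx|tx] := eqVneq t x.
    by subst t; rewrite (tpermC z); apply: Q1.
  apply: (@tperm_prod_trans _ _ x z); first exact: Q1.
  by rewrite (tpermC x); apply: Q1; rewrite // eq_sym.
have par ts : all dpair ts ->
    \prod_(t <- ts) tperm t.1 t.2 * (if odd (size ts) then tperm i j else 1) \in H.
  elim: ts => [_|t ts IHts] /=; first by rewrite big_nil mulg1 group1.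
  move=> /andP[dt /IHts]; rewrite big_cons.
  have step h0 : h0 \in H -> tperm t.1 t.2 * h0 * tperm i j \in H.
    move=> h0H; have := groupM (no_tperm_normal (tperm t.1 t.2) h0H) (Q _ _ _ _ dt ij).
    by rewrite conjgE tpermV !mulgA -(mulgA (_ * h0)) tperm2 mulg1.
  case: (odd _) => /= /step.
    by rewrite !mulgA -(mulgA _ (tperm i j)) tperm2.
  by rewrite mulg1.
apply/val_inj/setP => s; rewrite /= Alt_even.
have [ts sE dts] := prod_tpermP s.
have := par _ dts; rewrite -sE -(odd_perm_prod dts) -sE.
case: (odd_perm s) => /=; last by rewrite mulg1.
apply: contraTF => sH.
by rewrite groupMl // no_tperm.
Qed.

Definition has_three_cycle := exists i j k,
  [/\ i != j, i != k, j != k & R i j j k].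

(** If [h] sends [x] to [y] and [y] to a point other than [x] and [y], or fixes [x] and moves [y],
    then [(x y)(h x h y)] is a 3-cycle in [H]. *)
Lemma no_three_cycle_fixfree h :
  ~ has_three_cycle -> h \in H -> h != 1 -> fixfree_involution h.
Proof.
move=> n3 hH h1.
have c x y : x != y -> y = h x -> h y != x -> False.
  move=> xy yE hy; apply: n3; exists x, y, (h y); split=> //.
  - by rewrite eq_sym.
  - by rewrite {1}yE (inj_eq perm_inj).
  - by rewrite {2}yE tperm_comm_in.
have ff x : h x != x.
  apply/eqP => hx; have /existsP[y hy] : [exists y, h y != y].
    rewrite -negb_forall; apply: contraNN h1 => /forallP hid.
    by apply/eqP/permP => y; rewrite perm1; apply/eqP.
  have xy : x != y by apply: contraNneq hy => <-; rewrite hx.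
  apply: n3; exists y, x, (h y); split=> //.
  - by rewrite eq_sym.
  - by rewrite eq_sym.
  - by rewrite -{1}hx (inj_eq perm_inj).
  - by have := tperm_comm_in x y hH; rewrite hx (tpermC x y).
split=> // x; apply/eqP/negPn/negP => hhx.
by apply: (c x (h x)); rewrite // eq_sym.
Qed.

Lemma no_tperm_cases :
  [\/ H = 1%G, H = 'Alt_T%G
    | #|T| = 4 /\ {in H, forall h, h != 1 -> fixfree_involution h}].
Proof.
case: (EM has_three_cycle) => [[i [j [k [ij ik jk r]]]]|n3].
  by constructor 2; exact: three_cycle_Alt r.
have ff := no_three_cycle_fixfree n3.
case: (eqVneq (H : {set _}) 1) => [H1|/trivgPn[h hH h1]].
  by constructor 1; apply: val_inj.
constructor 3; split; last by move=> g gH; exact: ff.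
have [fh ih] := ff h hH h1.
have /existsP[i _] : [exists i : T, true].
  apply: contraNT h1 => /existsPn T0; apply/eqP/permP => x; have := T0 x => //.
(* Without such a point [h] would be the transposition of [i] and [h i]. *)
have [m] : exists m, m \notin [set i; h i].
  apply/existsP; rewrite -negb_forall; apply/forallP => Tall.
  have /negP := no_tperm (fh i); apply.
  suff <- : h = tperm (h i) i by [].
  apply/permP => x; have := Tall x; rewrite !inE => /orP[]/eqP ->.
    by rewrite tpermR.
  by rewrite tpermL ih.
rewrite !inE negb_or => /andP[mi mk].
have hmi : h m != i by apply: contraNneq mk => <-; rewrite ih.
have hmk : h m != h i by rewrite (inj_eq perm_inj).
have U : uniq [:: i; h i; m; h m].
  by rewrite /= !inE !negb_or !andbT [i == h i]eq_sym fh [i == m]eq_sym mi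
    [i == _]eq_sym hmi [_ == m]eq_sym mk [_ == h m]eq_sym hmk [m == _]eq_sym fh.
have card4 : #|[set x in [:: i; h i; m; h m]]| = 4 by rewrite cardsE (card_uniqP U).
rewrite -card4 -cardsT; congr #|pred_of_set _|; apply/setP => j; rewrite inE.
apply/esym/idPn; rewrite !inE !negb_or => /and4P[ji jk jm jhm].
(* A fifth point [j] is impossible: [h * h ^ t] would fix [j] and send [i] to [h m], although
   nontrivial elements of [H] have no fixed points. *)
pose t := tperm (h i) m.
have gH : h * h ^ t \in H by rewrite groupM // no_tperm_normal.
have jE : (h * h ^ t) j = j.
  rewrite permM conjgE !permM tpermV [tperm _ _ (h j)]tpermD ?ih.
  - by rewrite tpermD // eq_sym.
  - by rewrite (inj_eq perm_inj) eq_sym.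
  - by apply: contraNneq jhm => ->; rewrite ih.
have iE : (h * h ^ t) i = h m.
  by rewrite permM conjgE !permM tpermV tpermL tpermD // 1?eq_sym // eq_sym.
have [|/(_ j)] := ff _ gH.
  by apply: contraNneq hmi => g1; rewrite -iE g1 perm1.
by rewrite jE eqxx.
Qed.

End NoTransposition.

(** Multiplication in the Klein four-group, checked point by point. *)
Lemma double_tperm_mul (T : finType) (i j k l : T) : uniq [:: i; j; k; l] ->
  tperm i k * tperm j l * (tperm j k * tperm i l) = tperm i j * tperm k l.
Proof.
rewrite /= !inE !negb_or !andbT => /and3P[/and3P[ij ik il] /andP[jk jl] kl].
have [ji ki li] : [/\ j != i, k != i & l != i] by rewrite ![_ == i]eq_sym.
have [kj lj lk] : [/\ k != j, l != j & l != k].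
  by rewrite ![_ == j]eq_sym [l == _]eq_sym.
apply/permP => x; rewrite !permM.
case: (eqVneq x i) => [->|xi].
  by rewrite tpermL (tpermD jk lk) tpermR (tpermD ij lj) tpermL (tpermD kj lj).
case: (eqVneq x j) => [->|xj].
  by rewrite (tpermD ij kj) tpermL (tpermD jl kl) !tpermR (tpermD ki li).
case: (eqVneq x k) => [->|xk].
  by rewrite tpermR (tpermD ji li) (tpermD ji ki) tpermL (tpermD ik jk) tpermL.
case: (eqVneq x l) => [->|xl].
  by rewrite (tpermD il kl) tpermR tpermL (tpermD ik lk) (tpermD il jl) tpermR.
by rewrite !tpermD // eq_sym.
Qed.

Lemma disjoint_tperm_comm (T : finType) (i j k l : T) : uniq [:: i; j; k; l] ->
  tperm i j * tperm k l = tperm k l * tperm i j.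
Proof.
rewrite /= !inE !negb_or !andbT => /and3P[/and3P[ij ik il] /andP[jk jl] kl].
by rewrite conjgC tpermJ !tpermD // eq_sym.
Qed.

(** * Proper modular subgroups containing a transposition *)

Section WithTransposition.
Variables (T : finType) (H : {group {perm T}}).
Hypothesis modH : modular_subgroup H.
Implicit Types (i j k l m x : T) (s h : {perm T}).
Local Notation S i j := (tperm i j \in H).

Lemma tperm_in_trans j i k : S i j -> S j k -> S i k.
Proof.
have [->|ij] := eqVneq i j; first by [].
have [->|jk] := eqVneq j k; first by [].
have [->|ik] := eqVneq i k; first by rewrite tperm1 group1.
by move=> hij hjk; have := groupJ hij hjk; rewrite tpermJ tpermL tpermD // eq_sym.
Qed.

(** The involution [(i k)(j l)] commutes with its conjugate [(j k)(i l)] by [(i j)], and their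
    product is [(i j)(k l)]. Either outcome of modularity puts this product into [H]. *)
Lemma tperm_in_disjoint i j k l : uniq [:: i; j; k; l] -> S i j -> S k l.
Proof.
move=> U hij; have := U.
rewrite /= !inE !negb_or !andbT => /and3P[/and3P[ij ik il] /andP[jk jl] kl].
have yy : (tperm i k * tperm j l) * (tperm i k * tperm j l) = 1.
  rewrite {1}disjoint_tperm_comm ?mulgA.
    by rewrite -(mulgA (tperm j l)) tperm2 mulg1 tperm2.
  by rewrite /= !inE !negb_or ik ij il kl jl [k == j]eq_sym jk.
have yJ : (tperm i k * tperm j l) ^ tperm i j = tperm j k * tperm i l.
  by rewrite conjMg !tpermJ tpermL tpermR !tpermD // eq_sym.
have yJJ : (tperm j k * tperm i l) ^ tperm i j = tperm i k * tperm j l.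
  by rewrite -yJ -conjgM tperm2 conjg1.
have P := double_tperm_mul U.
have com : (tperm i k * tperm j l) * (tperm i k * tperm j l) ^ tperm i j
         = (tperm i k * tperm j l) ^ tperm i j * (tperm i k * tperm j l).
  have -> : (tperm i k * tperm j l) ^ tperm i j * (tperm i k * tperm j l)
          = (tperm i j * tperm k l) ^ tperm i j by rewrite -P [RHS]conjMg yJJ yJ.
  by rewrite yJ P conjMg !tpermJ tpermL tpermR !tpermD // (tpermC j).
have : tperm i j * tperm k l \in H.
  have [yH|] := modular_commuting_involution modH yy hij com.
    by rewrite -P -yJ groupM // groupJ.
  by rewrite yJ P.
by rewrite groupMl.
Qed.

Hypothesis H_proper : H != [set: {perm T}]%G.

(** The group found is I_{ij,kl}. As [H] is proper, it does not contain [(i k)], so modularity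
    applied to [(i k)] and its conjugate [(j l)] gives their product. *)
Lemma tperm_cases4 i j k l : #|T| = 4 -> uniq [:: i; j; k; l] -> S i j ->
  [/\ S k l, tperm i k * tperm j l \in H
    & H = <<[set tperm i j; tperm k l; tperm i k * tperm j l]>> :> {set _}].
Proof.
move=> T4 U hij; have hkl := tperm_in_disjoint U hij.
have Tall x : x \in [:: i; j; k; l].
  have /eqP : [set x in [:: i; j; k; l]] == setT.
    by rewrite eqEcard subsetT cardsT cardsE (card_uniqP U) T4.
  by move/setP/(_ x); rewrite !inE.
have nik : ~~ S i k.
  apply: contraNN H_proper => hik; apply/eqP/all_tperm_setT => x y.
  have all_i z : S i z.
    have := Tall z; rewrite !inE => /or4P[] /eqP -> //; first by rewrite tperm1.
    exact: tperm_in_trans hkl.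
  by apply: (@tperm_in_trans i); rewrite // tpermC.
have nil : ~~ S i l.
  by apply: contraNN nik => hil; apply: tperm_in_trans hil _; rewrite tpermC.
have := U; rewrite /= !inE !negb_or !andbT => /and3P[/and3P[ij ik il] /andP[jk jl] kl].
have aJ : tperm i k ^ (tperm i j * tperm k l) = tperm j l.
  rewrite conjgM !tpermJ tpermL [tperm i j k]tpermD // tpermL.
  by rewrite [tperm k l j]tpermD // eq_sym.
have U' : uniq [:: i; k; j; l].
  by rewrite /= !inE !negb_or ik ij il kl jl [k == j]eq_sym jk.
have h2 : tperm i k * tperm j l \in H.
  have := modular_commuting_involution modH (tperm2 i k) (groupM hij hkl).
  rewrite aJ disjoint_tperm_comm // => /(_ erefl)[hik|//].
  by rewrite hik in nik.
split=> //; set B := <<_>>; apply/eqP; rewrite eqEsubset; apply/andP; split; last first.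
  by rewrite gen_subG !subUset !sub1set hij hkl h2.
have [Bij Bkl B2] : [/\ tperm i j \in B, tperm k l \in B & tperm i k * tperm j l \in B].
  by split; rewrite mem_gen // !inE eqxx ?orbT.
have divB (x b : {perm T}) : b \in B -> x * b \in B -> x \in B.
  by move=> hb; rewrite groupMr.
(* An element fixing [i] also fixes [j], because [i] is exchanged in [H] with no point other than
   [j]; it is then 1 or [(k l)]. The generators reduce every element to this case. *)
have fixi h : h \in H -> h i = i -> h \in B.
  move=> hH hi; have : S i (h j) by rewrite -{1}hi -tpermJ groupJ.
  have := Tall (h j); rewrite !inE => /or4P[] /eqP hj; rewrite ?hj ?(negPf nik) ?(negPf nil) //.
    by move/eqP: hj; rewrite -{1}hi (inj_eq perm_inj) eq_sym (negPf ij).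
  have fixk (g : {perm T}) : g i = i -> g j = j -> g k = k -> g = 1.
    move=> gi gj gk; apply/permP => x; rewrite perm1.
    have := Tall x; rewrite !inE => /or4P[] /eqP -> //.
    have := Tall (g l); rewrite !inE => /or4P[] /eqP gl //; move/eqP: gl.
    - by rewrite -{1}gi (inj_eq perm_inj) eq_sym (negPf il).
    - by rewrite -{1}gj (inj_eq perm_inj) eq_sym (negPf jl).
    - by rewrite -{1}gk (inj_eq perm_inj) eq_sym (negPf kl).
  move=> _; have := Tall (h k); rewrite !inE => /or4P[] /eqP hk; move/eqP: (hk).
  - by rewrite -{1}hi (inj_eq perm_inj) eq_sym (negPf ik).
  - by rewrite -{1}hj (inj_eq perm_inj) eq_sym (negPf jk).
  - by rewrite (fixk h) ?group1.
  move=> _; apply: (divB _ _ Bkl); rewrite (fixk (h * tperm k l)) ?group1 // permM ?hi ?hj ?hk ?tpermR //.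
    by rewrite tpermD // eq_sym.
  by rewrite tpermD // eq_sym.
apply/subsetP => h hH.
have := Tall (h i); rewrite !inE => /or4P[] /eqP hi.
- exact: fixi.
- by apply: (divB _ _ Bij); apply: fixi; rewrite ?groupM // permM hi tpermR.
- by apply: (divB _ _ B2); apply: (fixi _ (groupM hH h2)); rewrite !permM hi tpermR tpermD // eq_sym.
apply: (divB _ _ Bkl); apply: (divB _ _ B2); apply: (fixi _ (groupM (groupM hH hkl) h2)).
rewrite !permM hi tpermR tpermR.
by rewrite tpermD // eq_sym.
Qed.

(** Being transposed by [H] is an equivalence of points, preserved by [H]. Since [H] is proper there
    is a [k] outside the class of [i]. On three points [k] is fixed by all of [H]. *)
Lemma tperm_cases i j : i != j -> S i j ->
  (#|T| = 3 /\ H = <[tperm i j]>%G) \/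
  #|T| = 4.
Proof.
move=> ij hij.
have [k nik] : exists k, ~~ S i k.
  apply/existsP; rewrite -negb_forall; apply: contraNN H_proper => /forallP all_i.
  apply/eqP/all_tperm_setT => x y; apply: (@tperm_in_trans i); last exact: all_i.
  by rewrite tpermC.
have ik : i != k by apply: contraNneq nik => <-; rewrite tperm1.
have jk : j != k by apply: contraNneq nik => <-.
have njk : ~~ S j k by apply: contraNN nik; exact: tperm_in_trans.
have inv h x y : h \in H -> S x y -> S (h x) (h y).
  by move=> hH hxy; rewrite -tpermJ groupJ.
(* Two further points [l] and [m] would be joined to [k] and, through [(k l)], also [m] to [i], so
   that [i] and [k] would be joined. *)
have D l m : uniq [:: i; j; k; l] -> m \notin [:: i; j; k] -> m = l.
  move=> U mU; apply/eqP; apply: contraNT nik => ml.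
  have := U; rewrite /= !inE !negb_or !andbT => /and3P[/and3P[_ _ il] /andP[_ jl] kl].
  move: mU; rewrite !inE !negb_or => /and3P[mi mj mk].
  have Skl : S k l by apply: tperm_in_disjoint U hij.
  have Skm : S k m.
    by apply: tperm_in_disjoint hij; rewrite /= !inE !negb_or ij ik jk ![_ == m]eq_sym mi mj mk.
  rewrite tpermC; apply: tperm_in_trans Skm _; rewrite tpermC.
  apply: tperm_in_disjoint Skl.
  by rewrite /= !inE !negb_or kl ![k == _]eq_sym ik mk ![l == _]eq_sym il ml eq_sym mi.
case: (boolP [exists l, l \notin [:: i; j; k]]) => [/existsP[l lU]|/existsPn noL].
  right; have U : uniq [:: i; j; k; l].
    move: lU; rewrite /= !inE !negb_or ij ik jk => /and3P[li lj lk].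
    by rewrite ![_ == l]eq_sym li lj lk.
  have <- : #|[:: i; j; k; l]| = 4 by exact/card_uniqP.
  apply: eq_card => x.
  case: (boolP (x \in [:: i; j; k])) => [|/(D l x U) ->].
    by rewrite !inE => /or3P[] ->; rewrite ?orbT.
  by rewrite !inE eqxx !orbT.
left; have Tall x : x \in [:: i; j; k] by have := noL x; rewrite negbK.
split.
  have <- : #|[:: i; j; k]| = 3 by apply/card_uniqP; rewrite /= !inE negb_or ij ik jk.
  by apply: eq_card => x; rewrite Tall.
apply/val_inj/eqP; rewrite eqEsubset /= cycle_subG hij andbT.
apply/subsetP => h hH.
have lone x : S k x -> x = k.
  by have := Tall x; rewrite !inE => /or3P[] /eqP -> //; rewrite tpermC ?(negPf nik) ?(negPf njk).
have hk : h k = k.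
  have := inv _ _ _ (groupVr hH) hij; have := Tall (h k); rewrite !inE => /or3P[] /eqP hk //.
    rewrite -{1}hk permK => /lone/(congr1 h); rewrite permKV hk => e.
    by rewrite e eqxx in ij.
  rewrite -{1}hk permK tpermC => /lone/(congr1 h); rewrite permKV hk => e.
  by rewrite e eqxx in ij.
have nk x : x != k -> h x != k.
  by apply: contraNN => /eqP e; apply/eqP/(@perm_inj _ h); rewrite e hk.
have h2 x : x != k -> (h x == i) || (h x == j).
  by move=> /nk; have := Tall (h x); rewrite !inE => /or3P[] ->; rewrite ?orbT.
have [hi|hi] := eqVneq (h i) i.
  suff -> : h = 1 by exact: group1.
  apply/permP => x; rewrite perm1; have := Tall x; rewrite !inE => /or3P[] /eqP -> //.
  have /orP[/eqP e|/eqP //] := h2 j jk.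
  by have /perm_inj e' : h i = h j by [rewrite hi e]; rewrite e' eqxx in ij.
have {}hi : h i = j by have := h2 i ik; rewrite (negPf hi) => /eqP.
suff -> : h = tperm i j by exact: cycle_id.
apply/permP => x; have := Tall x; rewrite !inE => /or3P[] /eqP ->.
- by rewrite tpermL.
- rewrite tpermR; have /orP[/eqP //|/eqP e] := h2 j jk.
  by have /perm_inj e' : h i = h j by [rewrite hi e]; rewrite e' eqxx in ij.
- by rewrite tpermD.
Qed.
End WithTransposition.

Lemma uniq_size_mem (T : finType) (s : seq T) x : uniq s -> size s = #|T| -> x \in s.
Proof.
move=> U sT; have : [set x in s] == setT.
  by rewrite eqEcard subsetT cardsT cardsE (card_uniqP U) sT leqnn.
by move=> /eqP/setP/(_ x); rewrite !inE.
Qed.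

Lemma exists_notin (T : finType) (s : seq T) : size s < #|T| -> exists x, x \notin s.
Proof.
move=> sT; apply/existsP; rewrite -negb_forall; apply: contraTN sT => /forallP hs.
rewrite -leqNgt; apply: leq_trans (card_size s).
by apply/subset_leq_card/subsetP => x _; exact: hs.
Qed.

(** * The Klein four-group and the comparison of modular subgroups *)

Section FixfreeInvolutions.
Variable T : finType.
Hypothesis T4 : #|T| = 4.
Implicit Types (g h : {perm T}) (x y : T).

Lemma fixfree_uniq h x y : fixfree_involution h -> y != x -> y != h x ->
  uniq [:: x; h x; y; h y].
Proof.
move=> [fh ih] yx yhx; rewrite /= !inE !negb_or !andbT.
have hxy : x != h y by apply: contraNneq yhx => ->; rewrite ih.
by rewrite hxy [x == h x]eq_sym fh [x == y]eq_sym yx [h x == y]eq_sym yhx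
  (inj_eq perm_inj) [x == y]eq_sym yx [y == h y]eq_sym fh.
Qed.

(** One value fixes the first exchanged pair, and the two remaining points must be exchanged as
    well. *)
Lemma fixfree_eq g h x :
  fixfree_involution g -> fixfree_involution h -> g x = h x -> g = h.
Proof.
move=> fg fh gh; apply/permP => y.
have [->|yx] := eqVneq y x; first by [].
have [yg|ygx] := eqVneq y (g x); first by rewrite yg fg.2 gh fh.2.
have Ug := fixfree_uniq fg yx ygx; rewrite gh in ygx.
have := fixfree_uniq fh yx ygx.
have := uniq_size_mem (h y) Ug (esym T4); rewrite !inE => /or4P[] /eqP hy.
- by rewrite hy /= !inE eqxx !orbT.
- by rewrite hy gh /= !inE eqxx !orbT /= !andbF.
- by rewrite hy /= !inE eqxx /= !andbF.
- by rewrite hy.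
Qed.

Lemma fixfree_tperm x y z t : uniq [:: x; y; z; t] ->
  fixfree_involution (tperm x y * tperm z t).
Proof.
move=> U; have c := disjoint_tperm_comm U.
split=> [|w]; last first.
  by rewrite -permM {1}c mulgA -(mulgA (tperm z t)) tperm2 mulg1 tperm2 perm1.
move=> w; have := U; rewrite /= !inE !negb_or !andbT => /and3P[/and3P[xy xz xt] /andP[yz yt] zt].
rewrite permM; have := uniq_size_mem w U (esym T4); rewrite !inE => /or4P[] /eqP ->.
- by rewrite tpermL tpermD // eq_sym.
- by rewrite tpermR tpermD // eq_sym.
- by rewrite [tperm x y z]tpermD // tpermL eq_sym.
- by rewrite [tperm x y t]tpermD // tpermR.
Qed.

Lemma fixfree_tpermE h x y : fixfree_involution h -> y != x -> y != h x ->
  h = tperm x (h x) * tperm y (h y).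
Proof.
move=> fh yx yhx; have U := fixfree_uniq fh yx yhx.
apply: (@fixfree_eq _ _ x) => //; first exact: fixfree_tperm.
have := U; rewrite /= !inE !negb_or !andbT => /and3P[/and3P[xy xz xt] /andP[yz yt] zt].
by rewrite permM tpermL tpermD // eq_sym.
Qed.

(** So a nontrivial modular subgroup on four points contains the Klein four-group: groups with a
    transposition by [tperm_cases4], the alternating group by parity, and the remaining ones because
    they are normal. *)
Lemma fixfree_in_modular (H : {group {perm T}}) h :
  modular_subgroup H -> H != 1%G -> fixfree_involution h -> h \in H.
Proof.
move=> mH H1 fh.
case: (eqVneq H [set: {perm T}]%G) => [->|HT]; first by rewrite inE.
case: (boolP [exists i, [exists j, (i != j) && (tperm i j \in H)]]).
  move=> /existsP[i /existsP[j /andP[ij hij]]].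
  have [k kU] : exists x, x \notin [:: i; j] by apply: exists_notin; rewrite T4.
  have [l lU] : exists x, x \notin [:: i; j; k] by apply: exists_notin; rewrite T4.
  move: kU lU; rewrite !inE !negb_or => /andP[ki kj] /and3P[li lj lk].
  have U : uniq [:: i; j; k; l].
    by rewrite /= !inE !negb_or ij ![_ == k]eq_sym ki kj ![_ == l]eq_sym li lj lk.
  have U' : uniq [:: i; j; l; k].
    by rewrite /= !inE !negb_or ij ![_ == k]eq_sym ki kj ![_ == l]eq_sym li lj lk.
  have [hkl h2 _] := tperm_cases4 mH HT T4 U hij.
  have [_ h2' _] := tperm_cases4 mH HT T4 U' hij.
  have := uniq_size_mem (h i) U (esym T4); rewrite !inE => /or4P[] /eqP hi.
  - by have := fh.1 i; rewrite hi eqxx.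
  - have hy : k != h i by rewrite hi.
    have hE := fixfree_tpermE fh ki hy; have := fixfree_uniq fh ki hy.
    rewrite hi in hE *; have := uniq_size_mem (h k) U (esym T4); rewrite !inE => /or4P[] /eqP hyE.
    + by rewrite hyE /= !inE eqxx !orbT.
    + by rewrite hyE /= !inE eqxx !orbT /= !andbF.
    + by rewrite hyE /= !inE eqxx /= !andbF.
    + by rewrite hE hyE groupM.
  - have ji : j != i by rewrite eq_sym.
    have hy : j != h i by rewrite hi eq_sym.
    have hE := fixfree_tpermE fh ji hy; have := fixfree_uniq fh ji hy.
    rewrite hi in hE *; have := uniq_size_mem (h j) U (esym T4); rewrite !inE => /or4P[] /eqP hyE.
    + by rewrite hyE /= !inE eqxx !orbT.
    + by rewrite hyE /= !inE eqxx /= !andbF.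
    + by rewrite hyE /= !inE eqxx !orbT /= !andbF.
    + by rewrite hE hyE .
  - have ji : j != i by rewrite eq_sym.
    have hy : j != h i by rewrite hi eq_sym.
    have hE := fixfree_tpermE fh ji hy; have := fixfree_uniq fh ji hy.
    rewrite hi in hE *; have := uniq_size_mem (h j) U (esym T4); rewrite !inE => /or4P[] /eqP hyE.
    + by rewrite hyE /= !inE eqxx !orbT.
    + by rewrite hyE /= !inE eqxx /= !andbF.
    + by rewrite hE hyE .
    + by rewrite hyE /= !inE eqxx !orbT /= !andbF.
move=> nt.
have no_tp i j : i != j -> tperm i j \notin H.
  by move=> ij; apply: contraNN nt => hij; apply/existsP; exists i; apply/existsP; exists j; rewrite ij.
have /card_gt0P[x _] : 0 < #|T| by rewrite T4.
have [y] : exists y, y \notin [:: x; h x] by apply: exists_notin; rewrite T4.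
rewrite !inE negb_or => /andP[yx yhx].
case: (no_tperm_cases mH no_tp) => [/eqP|->|[_ ffH]]; first by rewrite (negPf H1).
  rewrite Alt_even (fixfree_tpermE (x := x) (y := y) fh) // odd_permM !odd_tperm.
  by rewrite ![_ == h _]eq_sym !fh.1.
case/trivgPn: H1 => g gH g1; have fg := ffH g gH g1.
(* Conjugation by [s] turns [g] into an involution with the same value at [x] as [h], hence into
   [h]. *)
pose s := tperm (g x) (h x).
have gs : g ^ s \in H by exact: no_tperm_normal.
have gsx : (g ^ s) x = h x.
  by rewrite conjgE !permM tpermV [s x]tpermD ?fg.1 ?fh.1 // /s tpermL.
have gs1 : g ^ s != 1 by apply: contraNneq (fh.1 x) => e; rewrite -gsx e perm1.
by rewrite -(fixfree_eq (ffH _ gs gs1) fh gsx).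
Qed.
End FixfreeInvolutions.

(** Among modular subgroups these are the groups T_{ij} of S_3 and I_{ij,st} of S_4. *)
Definition singular_subgroup (T : finType) (H : {group {perm T}}) : Prop :=
  [\/ #|T| = 3 /\ exists i j : T, i != j /\ H = <[tperm i j]> :> {set _}
    | [/\ #|T| = 4, H != [set: {perm T}]%G & exists i j : T, i != j /\ tperm i j \in H]].

Lemma modular_cases (T : finType) (H : {group {perm T}}) : modular_subgroup H ->
  [\/ H = 1%G, H = [set: {perm T}]%G, H = 'Alt_T%G | singular_subgroup H \/
    #|T| = 4 /\ {in H, forall h, h != 1 -> fixfree_involution h}].
Proof.
move=> mH; case: (eqVneq H [set: {perm T}]%G) => [->|HT]; first by constructor 2.
case: (boolP [exists i, [exists j, (i != j) && (tperm i j \in H)]]).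
  move=> /existsP[i /existsP[j /andP[ij hij]]]; constructor 4; left.
  case: (tperm_cases mH HT ij hij) => [[T3 HE]|T4].
    by left; split=> //; exists i, j; rewrite HE.
  by right; split=> //; exists i, j.
move=> nt; case: (@no_tperm_cases _ _ mH) => [i j ij|||].
- by apply: contraNN nt => hij; apply/existsP; exists i; apply/existsP; exists j; rewrite ij.
- by constructor 1.
- by constructor 3.
- by constructor 4; right.
Qed.

(** The last two cases are the pairs that (c') forbids. Outside them one group is trivial or the
    whole group, both are alternating, or one lies in the Klein four-group and hence in the
    other. *)
Lemma modular_comparable (T : finType) (H1 H2 : {group {perm T}}) :
  modular_subgroup H1 -> modular_subgroup H2 ->
  [\/ H1 \subset H2, H2 \subset H1,
      singular_subgroup H1 /\ (singular_subgroup H2 \/ H2 = 'Alt_T%G)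
    | singular_subgroup H2 /\ H1 = 'Alt_T%G].
Proof.
move=> m1 m2.
have klein (K1 K2 : {group {perm T}}) : modular_subgroup K2 -> K2 != 1%G -> #|T| = 4 ->
    {in K1, forall h, h != 1 -> fixfree_involution h} -> K1 \subset K2.
  move=> mK2 n1 T4 hK; apply/subsetP => h hh.
  have [->|h1] := eqVneq h 1; first exact: group1.
  by apply: fixfree_in_modular => //; exact: hK.
case: (eqVneq H1 1%G) => [->|n1]; first by constructor 1; exact: sub1G.
case: (eqVneq H2 1%G) => [->|n2]; first by constructor 2; exact: sub1G.
case: (modular_cases m1) => [/eqP|->|H1A|[s1|[T4 k1]]].
- by rewrite (negPf n1).
- by constructor 2; exact: subsetT.
- case: (modular_cases m2) => [/eqP|->|H2A|[s2|[T4 k2]]].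
  + by rewrite (negPf n2).
  + by constructor 1; exact: subsetT.
  + by constructor 1; rewrite H1A H2A.
  + by constructor 4.
  + by constructor 2; exact: klein.
- case: (modular_cases m2) => [/eqP|->|H2A|[s2|[T4 k2]]].
  + by rewrite (negPf n2).
  + by constructor 1; exact: subsetT.
  + by constructor 3; split=> //; right.
  + by constructor 3; split=> //; left.
  + by constructor 2; exact: klein.
- by constructor 1; exact: klein.
Qed.

Lemma mem_set3 (T : finType) (a b c x : T) :
  [\/ x = a, x = b | x = c] -> x \in [set a; b; c].
Proof. by case=> ->; rewrite !inE eqxx ?orbT. Qed.

Lemma singular_T3s (H : {group 'S_3}) : singular_subgroup H -> (H : {set _}) \in T3s.
Proof.
case=> [[_ [i [j [ij ->]]]]|[]]; last by rewrite card_ord.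
apply: mem_set3; rewrite /T3.
have o x y : nat_of_ord x = y -> x = inord y :> 'I_3 by move=> <-; rewrite inord_val.
case E : (val i) (ltn_ord i) => [|[|[|?]]] //= _;
  case F : (val j) (ltn_ord j) => [|[|[|?]]] //= _;
  rewrite (o _ _ E) (o _ _ F).
- by case/eqP: ij; apply: val_inj; rewrite E F.
- by constructor 1.
- by constructor 3.
- by constructor 1; rewrite tpermC.
- by case/eqP: ij; apply: val_inj; rewrite E F.
- by constructor 2.
- by constructor 3; rewrite tpermC.
- by constructor 2; rewrite tpermC.
- by case/eqP: ij; apply: val_inj; rewrite E F.
Qed.

Lemma singular_I4s (H : {group 'S_4}) :
  modular_subgroup H -> singular_subgroup H -> (H : {set _}) \in I4s.
Proof.
move=> mH; case=> [[]|[T4 HT [i [j [ij hij]]]]]; first by rewrite card_ord.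
(* If [0] is neither [i] nor [j], the complementary transposition, which is also in [H], moves
   it. *)
have [x x0 h0] : exists2 x : 'I_4, x != inord 0 & tperm (inord 0) x \in H.
  have [e|i0] := eqVneq i (inord 0); first by exists j; rewrite -e // eq_sym.
  have [e|j0] := eqVneq j (inord 0); first by exists i; rewrite -e // tpermC.
  have [l] : exists x, x \notin [:: i; j; inord 0] by apply: exists_notin; rewrite T4.
  rewrite !inE !negb_or => /and3P[li lj l0]; exists l => //.
  apply: tperm_in_disjoint hij => //.
  by rewrite /= !inE !negb_or ij i0 j0 ![_ == l]eq_sym li lj l0.
pose o k : 'I_4 := inord k.
have U a b c d : uniq [:: a; b; c; d] -> all (gtn 4) [:: a; b; c; d] ->
    tperm (o a) (o b) \in H -> (H : {set _}) = I4 a b c d.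
  move=> Uabcd lt4 hab; have [|_ _ ->//] := tperm_cases4 mH HT T4 _ hab (k := o c) (l := o d).
  have : map val [:: o a; o b; o c; o d] = [:: a; b; c; d].
    by move: lt4 => /= /and5P[a4 b4 c4 d4 _]; rewrite !inordK.
  by move=> e; rewrite -(map_inj_uniq val_inj) e.
apply: mem_set3.
have ox y : nat_of_ord x = y -> x = inord y by move=> <-; rewrite inord_val.
case E : (val x) (ltn_ord x) => [|[|[|[|?]]]] //= _.
- by rewrite (ox _ E) eqxx in x0.
- by constructor 1; apply: U; rewrite // /o -(ox _ E).
- by constructor 2; apply: U; rewrite // /o -(ox _ E).
- by constructor 3; apply: U; rewrite // /o -(ox _ E).
Qed.

(** * Transport between permutations of letters and permutations of indices *)

Lemma modular_subgroup_inj (aT rT : finGroupType) (f : {morphism [set: aT] >-> rT})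
    (H : {group aT}) :
  'injm f -> modular_subgroup (f @* H)%G -> modular_subgroup H.
Proof.
move=> inj_f mH Y Z YZ.
rewrite -(injmSK inj_f) ?subsetT // injmI ?subsetT // !morphimY ?subsetT // injmI ?subsetT //.
exact: (mH (f @* Y)%G (f @* Z)%G (morphimS f YZ)).
Qed.

Section ConjugatePermutation.
Variables (X Y : finType) (f : X -> Y) (g : Y -> X).
Hypotheses (fK : cancel f g) (gK : cancel g f).

Lemma perm_transfer_inj (s : {perm X}) : injective (f \o s \o g).
Proof. exact: inj_comp (inj_comp (can_inj fK) perm_inj) (can_inj gK). Qed.

Definition perm_transfer (s : {perm X}) : {perm Y} := perm (@perm_transfer_inj s).

Lemma perm_transferE s y : perm_transfer s y = f (s (g y)).
Proof. by rewrite permE. Qed.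

Lemma perm_transferM : {in [set: {perm X}] &, {morph perm_transfer : s t / s * t}}.
Proof.
by move=> s t _ _; apply/permP => y; rewrite !(permM, perm_transferE) fK.
Qed.

Canonical perm_transfer_morphism := Morphism perm_transferM.

Lemma perm_transfer_injm : 'injm perm_transfer.
Proof.
apply/injmP => s t _ _ e; apply/permP => x; apply: (can_inj fK).
by rewrite -{1 2}(fK x) -!perm_transferE e.
Qed.

Lemma letter_perm_transfer (e : X -> nat) (e' : Y -> nat) s :
  injective e' -> e =1 e' \o f -> letter_perm e s =1 letter_perm e' (perm_transfer s).
Proof.
move=> je' ee' x; rewrite /letter_perm.
case: pickP => [i /eqP ei|ni]; case: pickP => [j /eqP ej|nj] //.
- by rewrite ee' /= perm_transferE; congr (e' (f (s _))); rewrite -[i]fK; congr g;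
    apply: je'; rewrite ej -ei ee'.
- by have := nj (f i); rewrite -ei ee' /= eqxx.
- by have := ni (g j); rewrite -ej ee' /= gK eqxx.
Qed.
End ConjugatePermutation.

Lemma perm_transferK (X Y : finType) (f : X -> Y) (g : Y -> X)
    (fK : cancel f g) (gK : cancel g f) s :
  perm_transfer fK gK (perm_transfer gK fK s) = s.
Proof. by apply/permP => y; rewrite !perm_transferE !gK. Qed.

Section Enumeration.
Variables (k : nat) (e : 'I_k -> nat) (A : {fset nat}).
Hypothesis eA : enumerates e A.

Lemma enumerates_bij : exists f : 'I_k -> A, exists g : A -> 'I_k,
  [/\ cancel f g, cancel g f & e =1 val \o f].
Proof.
have [je hA] := eA.
have eiA i : e i \in A by rewrite hA codom_f.
have Ae (a : A) : val a \in codom e by rewrite -hA; exact: valP.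
exists (fun i => [` eiA i]%fset), (fun a => iinv (Ae a)); split=> //.
- by move=> i; apply: je; rewrite f_iinv.
- by move=> a; apply: val_inj; rewrite /= f_iinv.
Qed.

Lemma enumerates_perm (s : {perm A}) :
  exists t : 'S_k, letter_perm val s =1 letter_perm e t.
Proof.
have [f [g [fK gK ef]]] := enumerates_bij.
exists (perm_transfer gK fK s) => x.
by rewrite (letter_perm_transfer fK gK _ val_inj ef) perm_transferK.
Qed.

(** Condition (b) is about permutations of the alphabet, (c') about S_k; this carries modularity
    from the former to the latter. *)
Lemma enumerates_modular (U : Type) (N : variety U) w (je : injective e) :
  modular_subgroup (Group (stab_on_group_set N w (@val_inj _ _ A))) ->
  modular_subgroup (Group (stab_on_group_set N w je)).
Proof.
have [f [g [fK gK ef]]] := enumerates_bij.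
move=> mS; apply: (modular_subgroup_inj (perm_transfer_injm fK gK)).
suff -> : (perm_transfer fK gK @* Group (stab_on_group_set N w je))%G =
  Group (stab_on_group_set N w (@val_inj _ _ A)) by [].
have E s : (perm_transfer fK gK s \in stab_on N val w) = (s \in stab_on N e w).
  rewrite !inE; congr `[< satisfies N w _ >].
  by apply: eq_wrename => x _; rewrite (letter_perm_transfer fK gK _ val_inj ef).
apply/val_inj/setP => s; apply/idP/idP.
  by move=> /morphimP[t _ ht ->]; rewrite E.
move=> hs; rewrite -(perm_transferK fK gK s) mem_morphim ?inE //.
by move: hs; rewrite -{1}(perm_transferK fK gK s) E inE.
Qed.
End Enumeration.

Local Close Scope group_scope.
Local Open Scope variety_scope.

(** * Terms and identities *)

(** Identities of arbitrary varieties involve the unary operations, so words do not suffice. Letters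
    have an arbitrary type, so that elements of an algebra can serve as letters. *)
Inductive term (U X : Type) :=
  Var (x : X) | Mul (s t : term U X) | Op (o : U) (t : term U X).
Arguments Var {U X}.

Section Terms.
Variables (U : Type).

Fixpoint teval (X : Type) (S : ualg U) (f : X -> S) (t : term U X) : S :=
  match t with
  | Var x => f x
  | Mul s t => teval f s ** teval f t
  | Op o t => uop o (teval f t)
  end.

Fixpoint tsubst (X Y : Type) (h : X -> term U Y) (t : term U X) : term U Y :=
  match t with
  | Var x => h x
  | Mul s t => Mul (tsubst h s) (tsubst h t)
  | Op o t => Op o (tsubst h t)
  end.

Fixpoint tletters (X : Type) (t : term U X) : seq X :=
  match t with
  | Var x => [:: x]
  | Mul s t => tletters s ++ tletters t
  | Op o t => tletters t
  end.

Lemma teval_subst (X Y : Type) (S : ualg U) (f : Y -> S) (h : X -> term U Y) t :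
  teval f (tsubst h t) = teval (fun x => teval f (h x)) t.
Proof. by elim: t => //= [s -> t ->|o t ->]. Qed.

Lemma teval_hom (X : Type) (A B : ualg U) (g : A -> B) (f : X -> A) t :
  is_hom g -> g (teval f t) = teval (g \o f) t.
Proof. by case=> gM gO; elim: t => //= [s IHs t IHt|o t IHt]; rewrite ?gM ?gO ?IHs ?IHt. Qed.

Lemma eq_in_teval (X : eqType) (S : ualg U) (f g : X -> S) t :
  {in tletters t, f =1 g} -> teval f t = teval g t.
Proof.
elim: t => [x|s IHs t IHt|o t IHt] /= fg; first by apply: fg; rewrite inE.
  by rewrite IHs ?IHt // => x xs; apply: fg; rewrite mem_cat xs ?orbT.
by rewrite IHt.
Qed.

Lemma eq_in_tsubst (X : eqType) (Y : Type) (f g : X -> term U Y) t :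
  {in tletters t, f =1 g} -> tsubst f t = tsubst g t.
Proof.
elim: t => [x|s IHs t IHt|o t IHt] /= fg; first by apply: fg; rewrite inE.
  by rewrite IHs ?IHt // => x xs; apply: fg; rewrite mem_cat xs ?orbT.
by rewrite IHt.
Qed.

Lemma tsubst_Var (X : Type) (t : term U X) : tsubst Var t = t.
Proof. by elim: t => //= [s -> t ->|o t ->]. Qed.

Lemma tletters_subst (X Y : eqType) (h : X -> term U Y) t y :
  (y \in tletters (tsubst h t)) = has (fun x => y \in tletters (h x)) (tletters t).
Proof.
elim: t => [x|s IHs t IHt|o t IHt] /=; first by rewrite orbF.
  by rewrite mem_cat has_cat IHs IHt.
exact: IHt.
Qed.

Lemma tletters_neq0 (X : eqType) (t : term U X) : exists x, x \in tletters t.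
Proof.
elim: t => [x|s [x hx] t _|o t [x hx]] /=; exists x => //; first by rewrite inE.
by rewrite mem_cat hx.
Qed.

Definition Id (V : ualg U -> Prop) (X : Type) (s t : term U X) : Prop :=
  forall S, V S -> forall f : X -> S, teval f s = teval f t.

(** Only finitely many letters occur; they are numbered by their positions in [l], and [x0] is the
    default value of [nth]. *)
Lemma Id_letters (V : ualg U -> Prop) (X : eqType) (S : ualg U) (f : X -> S) s t :
  (forall s t : term U nat, Id V s t -> forall f : nat -> S, teval f s = teval f t) ->
  Id V s t -> teval f s = teval f t.
Proof.
move=> satS hst; set l := tletters s ++ tletters t.
have [x0 _] := tletters_neq0 s.
have /satS/(_ (f \o nth x0 l)) : Id V (tsubst (Var \o index^~ l) s) (tsubst (Var \o index^~ l) t).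
  by move=> A VA g; rewrite !teval_subst; exact: hst.
rewrite !teval_subst /= => e.
rewrite -[LHS](@eq_in_teval _ _ (fun x => f (nth x0 l (index x l)))) ?e.
  by apply: eq_in_teval => x xt; rewrite nth_index // mem_cat xt orbT.
by move=> x xs; rewrite nth_index // mem_cat xs.
Qed.

Section Birkhoff.
Variables (V : variety U) (S : ualg U).
Hypothesis satS :
  forall s t : term U nat, Id V s t -> forall f : nat -> S, teval f s = teval f t.

(** With the elements of [S] as letters, each failing identity is refuted in some algebra of [V].
    The values of terms form a subalgebra [B] of the product of these algebras, and [S] is an image
    of [B]. *)
Lemma birkhoff : V S.
Proof.
pose I := {p : term U S * term U S | ~ Id V p.1 p.2}.
have sep (i : I) : exists A : {A : ualg U & S -> A},
    V (projT1 A) /\ teval (projT2 A) (sval i).1 <> teval (projT2 A) (sval i).2.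
  case: i => -[s t] /= /existsNP[A /not_implyP[VA /existsNP[f ne]]].
  by exists (existT _ A f).
have [A hA] := choice sep.
pose P := prod_ualg (fun i => projT1 (A i)).
have [Vh Vs Vp] := varietyP V.
have VP : V P by apply: Vp => i; case: (hA i).
pose g : S -> P := fun x i => projT2 (A i) x.
have evP t i : teval g t i = teval (projT2 (A i)) t.
  exact: (teval_hom g t (hom_proj (fun i => projT1 (A i)) i)).
pose B := {p : P | exists t, p = teval g t}.
have Bmul (p q : B) : exists t, sval p ** sval q = teval g t.
  by case: p q => [p [s ps]] [q [t qt]]; exists (Mul s t); rewrite /= ps qt.
have Bop o (p : B) : exists t, uop o (sval p) = teval g t.
  by case: p => [p [s ps]]; exists (Op o s); rewrite /= ps.
have Binh : inhabited B.
  have [x] := ualg_inhabited S.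
  by constructor; exists (g x), (Var x).
have BA (p q r : B) : exist _ _ (Bmul p (exist _ _ (Bmul q r))) =
    exist _ _ (Bmul (exist _ _ (Bmul p q)) r) :> B.
  by apply: eq_exist; exact: (@mulA _ P).
pose BB := @Ualg U B (fun p q => exist _ _ (Bmul p q)) (fun o p => exist _ _ (Bop o p)) Binh BA.
have VB : V BB.
  apply: (Vs BB P sval) VP => //.
  by move=> p q; case: p q => [p hp] [q hq] /= e; exact: eq_exist.
have rep (p : B) : exists t, sval p = teval g t by case: p.
have [r hr] := choice rep.
(* Terms with equal values in the product are separated by no factor, so they form an identity of
   [V], which holds in [S]. *)
have welldef s t : teval g s = teval g t -> teval id s = teval id t :> S.
  move=> e; have : Id V s t.
    apply: contrapT => ne; have [_] := hA (exist _ (s, t) ne); apply.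
    by rewrite -!evP e.
  exact: (@Id_letters V {classic S} S id).
apply: (Vh BB S (fun p : BB => teval id (r p))) VB.
  split=> [p q|o p].
    rewrite -[RHS]/(teval id (Mul (r p) (r q))); apply: welldef.
    by rewrite -hr /= !hr.
  rewrite -[RHS]/(teval id (Op o (r p))); apply: welldef.
  by rewrite -hr /= !hr.
move=> x; have hx : exists t, g x = teval g t by exists (Var x).
exists (exist _ (g x) hx); rewrite -[RHS]/(teval id (Var x)).
by apply: welldef; rewrite -hr.
Qed.
End Birkhoff.
End Terms.

(** As terms are bracketed, associativity is imposed on the congruence; the quotient of the terms is
    then a [ualg]. *)
Record fully_invariant (U : Type) (R : term U nat -> term U nat -> Prop) : Prop := FullyInvariant {
  fi_refl : forall s, R s s;
  fi_sym : forall s t, R s t -> R t s;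
  fi_trans : forall s t u, R s t -> R t u -> R s u;
  fi_mul : forall s s' t t', R s s' -> R t t' -> R (Mul s t) (Mul s' t');
  fi_op : forall o s t, R s t -> R (Op o s) (Op o t);
  fi_assoc : forall s t u, R (Mul s (Mul t u)) (Mul (Mul s t) u);
  fi_subst : forall h s t, R s t -> R (tsubst h s) (tsubst h t) }.

Section FullyInvariant.
Variable U : Type.
Local Notation T := (term U nat).
Implicit Types (s t u : T) (R : T -> T -> Prop) (V W Y Z : variety U).

Lemma Id_fully_invariant (V : ualg U -> Prop) : fully_invariant (Id V (X := nat)).
Proof.
split=> //.
- by move=> s t e S VS f; rewrite e.
- by move=> s t u e1 e2 S VS f; rewrite e1 // e2.
- by move=> s s' t t' e1 e2 S VS f /=; rewrite e1 // e2.
- by move=> o s t e S VS f /=; rewrite e.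
- by move=> s t u S VS f /=; rewrite mulA.
- by move=> h s t e S VS f; rewrite !teval_subst; exact: e.
Qed.

Lemma fi_tsubst R (h g : nat -> T) t : fully_invariant R ->
  (forall x, R (h x) (g x)) -> R (tsubst h t) (tsubst g t).
Proof.
move=> fR hg; elim: t => [x|s IHs t IHt|o t IHt] /=; first exact: hg.
  exact: fi_mul.
exact: fi_op.
Qed.

Lemma fi_and (R1 R2 : T -> T -> Prop) : fully_invariant R1 -> fully_invariant R2 ->
  fully_invariant (fun s t => R1 s t /\ R2 s t).
Proof.
move=> f1 f2; split.
- by move=> s; split; exact: fi_refl.
- by move=> s t []; split; exact: fi_sym.
- by move=> s t u [a b] [c d]; split; [exact: fi_trans a c | exact: fi_trans b d].
- by move=> s s' t t' [a b] [c d]; split; exact: fi_mul.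
- by move=> o s t [a b]; split; exact: fi_op.
- by move=> s t u; split; exact: fi_assoc.
- by move=> h s t [a b]; split; exact: fi_subst.
Qed.

(** For two congruences this is their join; no symmetric closure is taken, as both relations are
    symmetric. *)
Definition linked R1 R2 : T -> T -> Prop :=
  clos_refl_trans T (fun s t => R1 s t \/ R2 s t).

Lemma linked_l R1 R2 s t : R1 s t -> linked R1 R2 s t.
Proof. by move=> h; apply: rt_step; left. Qed.

Lemma linked_r R1 R2 s t : R2 s t -> linked R1 R2 s t.
Proof. by move=> h; apply: rt_step; right. Qed.

Lemma linked_map R1 R2 (F : T -> T) s t :
  (forall s t, R1 s t -> R1 (F s) (F t)) -> (forall s t, R2 s t -> R2 (F s) (F t)) ->
  linked R1 R2 s t -> linked R1 R2 (F s) (F t).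
Proof.
move=> h1 h2; elim=> {s t} [s t [/h1|/h2]|s|s t u _ h _ h'].
- exact: linked_l.
- exact: linked_r.
- exact: rt_refl.
- exact: rt_trans h h'.
Qed.

Lemma linked_fully_invariant R1 R2 :
  fully_invariant R1 -> fully_invariant R2 -> fully_invariant (linked R1 R2).
Proof.
move=> f1 f2; split.
- by move=> s; exact: rt_refl.
- move=> s t; elim=> {s t} [s t [h|h]|s|s t u _ h _ h'].
  + by apply: linked_l; exact: fi_sym.
  + by apply: linked_r; exact: fi_sym.
  + exact: rt_refl.
  + exact: rt_trans h' h.
- by move=> s t u; exact: rt_trans.
- move=> s s' t t' hs ht; apply: (@rt_trans _ _ _ (Mul s' t)).
    apply: (linked_map (F := fun a => Mul a t) _ _ hs) => a b h;
      by apply: fi_mul => //; exact: fi_refl.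
  apply: (linked_map (F := fun b => Mul s' b) _ _ ht) => a b h;
    by apply: fi_mul => //; exact: fi_refl.
- by move=> o s t; apply: linked_map => a b h; exact: fi_op.
- by move=> s t u; apply: linked_l; exact: fi_assoc.
- by move=> h s t; apply: linked_map => a b; exact: fi_subst.
Qed.

Section Quotient.
Variable R : T -> T -> Prop.
Hypothesis fR : fully_invariant R.

(** A class is encoded as the predicate [R t]. The quotient is the relatively free algebra of
    countable rank. *)
Definition quotient_carrier := {P : T -> Prop | exists t, P = R t}.

Definition term_class t : quotient_carrier := exist _ (R t) (ex_intro _ t erefl).

Lemma term_class_eq s t : term_class s = term_class t <-> R s t.
Proof.
split=> [[e]|h]; first by rewrite e; exact: fi_refl.
apply: eq_exist; apply/funext => u; apply/propext; split=> h'.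
  by apply: (fi_trans fR) h'; exact: fi_sym.
exact: (fi_trans fR) h h'.
Qed.

Lemma quotient_rep (p : quotient_carrier) : exists t, p = term_class t.
Proof. by case: p => P [t e]; exists t; exact: eq_exist. Qed.

Definition quotient_repr p : T := projT1 (cid (quotient_rep p)).

Lemma quotient_reprK p : term_class (quotient_repr p) = p.
Proof. by rewrite /quotient_repr; case: cid. Qed.

Lemma term_classK t : R (quotient_repr (term_class t)) t.
Proof. by apply/term_class_eq; rewrite quotient_reprK. Qed.

Definition quotient_mul p q := term_class (Mul (quotient_repr p) (quotient_repr q)).
Definition quotient_op o p := term_class (Op o (quotient_repr p)).

Lemma quotient_mulA p q r :
  quotient_mul p (quotient_mul q r) = quotient_mul (quotient_mul p q) r.
Proof.
apply/term_class_eq; apply: (fi_trans fR).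
  by apply: (fi_mul fR); [exact: (fi_refl fR) | exact: term_classK].
apply: (fi_trans fR); first exact: (fi_assoc fR).
apply: (fi_mul fR); last exact: (fi_refl fR).
by apply: (fi_sym fR); exact: term_classK.
Qed.

Definition quotient_ualg : ualg U :=
  @Ualg U quotient_carrier quotient_mul quotient_op
    (inhabits (term_class (Var 0))) quotient_mulA.

Lemma quotient_teval (h : nat -> T) t :
  teval (fun x => term_class (h x) : quotient_ualg) t = term_class (tsubst h t).
Proof.
elim: t => [//|s IHs t IHt|o t IHt] /=; rewrite ?IHs IHt; apply/term_class_eq.
  by apply: (fi_mul fR); exact: term_classK.
by apply: (fi_op fR); exact: term_classK.
Qed.

(** Every valuation in the quotient lifts to a substitution, under which [R] is stable; [birkhoff]
    concludes. *)
Lemma quotient_in_variety V : (forall s t, Id V s t -> R s t) -> V quotient_ualg.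
Proof.
move=> VR; apply: birkhoff => s t e f.
have -> : f = fun x => term_class (quotient_repr (f x)).
  by apply/funext => x; rewrite quotient_reprK.
rewrite !quotient_teval; apply/term_class_eq.
by apply: (fi_subst fR); exact: VR.
Qed.

Lemma quotient_Id (V : ualg U -> Prop) s t : V quotient_ualg -> Id V s t -> R s t.
Proof.
move=> VQ /(_ _ VQ (fun x => term_class (Var x))).
by rewrite !quotient_teval !tsubst_Var => /term_class_eq.
Qed.
End Quotient.

(** The quotient by the join of the two congruences lies in both varieties. *)
Lemma Id_meet V W s t : Id (V `&` W)%O s t -> linked (Id V (X := nat)) (Id W (X := nat)) s t.
Proof.
have fL := linked_fully_invariant (Id_fully_invariant V) (Id_fully_invariant W).
move=> h; refine (quotient_Id (fR := fL) _ h); split; apply: quotient_in_variety.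
  exact: linked_l.
exact: linked_r.
Qed.

Lemma sat_variety s t : is_variety (fun S : ualg U => forall f : nat -> S, teval f s = teval f t).
Proof.
split.
- move=> A B g hg sg hA f; have [r hr] := choice sg.
  have -> : f = g \o (r \o f) by apply/funext => x; rewrite /= hr.
  by rewrite -!(teval_hom _ _ hg) hA.
- by move=> A B g hg jg hB f; apply: jg; rewrite !teval_hom.
- move=> I A h f; apply: functional_extensionality_dep => i.
  by rewrite !(teval_hom f _ (hom_proj A i)).
Qed.

Lemma Id_join V W s t : Id V s t -> Id W s t -> Id (V `|` W)%O s t.
Proof.
move=> hV hW S hS; apply: (hS (Variety (sat_variety s t))) => A VA f; [exact: hV | exact: hW].
Qed.

(** The hypothesis is the order-dual modular law for the congruences of identities. One inclusion of
    varieties holds in any lattice; the other is tested on identities through [birkhoff]. *)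
Lemma modular_variety V :
  (forall Y Z, (Y <= Z)%O -> forall s t, Id Y s t -> linked (Id V (X := nat)) (Id Z (X := nat)) s t ->
     linked (fun s t => Id V s t /\ Id Y s t) (Id Z (X := nat)) s t) ->
  modular_element V.
Proof.
move=> H Y Z YZ; apply/le_anti/andP; split; last first.
  rewrite leUx !lexI leIr leUr YZ !andbT.
  exact: le_trans (leIl _ _) (leUl _ _).
apply/asboolP => S [SVY SZ]; apply: birkhoff => s t st.
have hY : Id Y s t 
  by have /asboolP YJ : (Y <= (V `&` Z) `|` Y)%O := leUr _ _; move=> A /YJ/st.
have /Id_meet hVZ : Id (V `&` Z)%O s t 
  by have /asboolP ZJ : (V `&` Z <= (V `&` Z) `|` Y)%O := leUl _ _; move=> A /ZJ/st.
elim: (H Y Z YZ s t hY hVZ) => {s t st hY hVZ} [s t [[hV hY]|hZ]|s|s t u _ h _ h'] f //.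
- exact: (Id_join hV hY).
- exact: hZ.
- by rewrite h.
Qed.

End FullyInvariant.

(** * Terms equal to zero in a nil-variety *)

Definition is_zero (U : Type) (S : ualg U) (z : S) : Prop :=
  forall a, z ** a = z /\ a ** z = z.

Lemma is_zero_uniq (U : Type) (S : ualg U) (z z' : S) : is_zero z -> is_zero z' -> z = z'.
Proof. by move=> hz hz'; rewrite -(hz z').1 (hz' z).2. Qed.

Section Replacement.
Variable U : Type.
Implicit Types (s t p q : term U nat) (A : pred nat).

Definition replace A p : nat -> term U nat := fun b => if A b then p else Var b.

Lemma tletters_replace A p q : has A (tletters q) ->
  (forall b, b \in tletters q -> ~~ A b -> b \in tletters p) ->
  tletters (tsubst (replace A p) q) =i tletters p.
Proof.
move=> /hasP[a aq Aa] h y; rewrite tletters_subst; apply/hasP/idP.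
  move=> [b bq]; rewrite /replace; case: ifPn => // nAb.
  by rewrite inE => /eqP ->; exact: h.
by move=> yp; exists a; rewrite // /replace Aa.
Qed.

(* If [a] occurs in [s] only, substitute [p] for [a] in [s]; if it occurs in [t]
   only, substitute [p] in [t] for every letter not in [s]. *)
Lemma absorb_term (R : term U nat -> term U nat -> Prop) s t :
  fully_invariant R -> R s t -> ~ tletters s =i tletters t ->
  exists q A, [/\ q = s \/ q = t, has A (tletters q),
    forall b, b \in tletters q -> ~~ A b -> b \in tletters s
    & forall p, R s (tsubst (replace A p) q)].
Proof.
move=> fR st /existsNP[a ne].
case: (boolP (a \in tletters s)) => as_.
  exists s, (pred1 a); split; first by left.
  - by apply/hasP; exists a => //=.
  - by [].
  move=> p; apply: (fi_trans fR st); apply: (fi_sym fR).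
  have -> : t = tsubst (replace (pred1 a) p) t; last exact: fi_subst.
  rewrite -[LHS]tsubst_Var; apply: eq_in_tsubst => b bt.
  by rewrite /replace /=; case: eqP => // e; rewrite e in bt; rewrite as_ bt in ne.
have at_ : a \in tletters t by apply: contrapT => /negP nt; rewrite (negPf as_) (negPf nt) in ne.
exists t, [pred b | b \notin tletters s]; split; first by right.
- by apply/hasP; exists a.
- by move=> b _ /=; rewrite negbK.
move=> p; rewrite -{1}[s](_ : tsubst (replace [pred b | b \notin tletters s] p) s = s).
  exact: fi_subst.
rewrite -[RHS]tsubst_Var; apply: eq_in_tsubst => b bs.
by rewrite /replace /= bs.
Qed.

End Replacement.

Section NilVariety.
Variables (U : Type) (N : variety U).
Hypothesis nilN : nil_variety N.
Hypothesis opN : forall S, N S -> forall o (x : S), is_zero (uop o x).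
Local Notation T := (term U nat).
Implicit Types (s t p q : T) (A : pred nat).

Definition null t : Prop := forall S, N S -> forall f : nat -> S, is_zero (teval f t).

Lemma null_Id s t : null s -> null t -> Id N s t.
Proof. by move=> hs ht S NS f; apply: is_zero_uniq; [exact: hs | exact: ht]. Qed.

Lemma Id_null s t : Id N s t -> null s -> null t.
Proof. by move=> e h S NS f; rewrite -e //; exact: h. Qed.

Lemma null_mull s t : null s -> null (Mul s t).
Proof. by move=> h S NS f /=; rewrite (h S NS f (teval f t)).1; exact: h. Qed.

Lemma null_mulr s t : null t -> null (Mul s t).
Proof. by move=> h S NS f /=; rewrite (h S NS f (teval f s)).2; exact: h. Qed.

Lemma null_op o t : null (Op o t).
Proof. by move=> S NS f; exact: opN. Qed.

Lemma null_subst h s : null s -> null (tsubst h s).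
Proof. by move=> hs S NS f; rewrite teval_subst; exact: hs. Qed.

Lemma null_replace A p q : null p -> has A (tletters q) -> null (tsubst (replace A p) q).
Proof.
move=> np; elim: q => [x|s IHs t IHt|o t _] /=.
- by rewrite orbF /replace => ->.
- by rewrite has_cat => /orP[/IHs|/IHt]; [exact: null_mull | exact: null_mulr].
- by move=> _; exact: null_op.
Qed.

Definition tpow t n : T := iter n (Mul t) t.

(** One exponent serves all terms: it is the one at which the first generator of the relatively free
    algebra becomes zero. The second generator stands for an arbitrary factor. *)
Lemma null_tpow : exists n, forall t, null (tpow t n).
Proof.
have fN := Id_fully_invariant N.
have NQ : N (quotient_ualg fN) by apply: quotient_in_variety.
have [z [z0 hz]] := nilN NQ; pose c x : quotient_ualg fN := term_class (Id N (X := nat)) (Var x).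
have [n hn] := hz (c 0); exists n => t S NS f a.
have ev : teval c (tpow (Var 0) n) = z.
  by rewrite -hn; elim: n {hn} => //= n ->.
have e1 : Id N (Mul (tpow (Var 0) n) (Var 1)) (tpow (Var 0) n).
  have := (z0 (c 1)).1; rewrite -{1 2}ev -[_ ** _]/(teval c (Mul (tpow (Var 0) n) (Var 1))).
  by rewrite !quotient_teval !tsubst_Var => /(term_class_eq fN).
have e2 : Id N (Mul (Var 1) (tpow (Var 0) n)) (tpow (Var 0) n).
  have := (z0 (c 1)).2; rewrite -{1 2}ev -[_ ** _]/(teval c (Mul (Var 1) (tpow (Var 0) n))).
  by rewrite !quotient_teval !tsubst_Var => /(term_class_eq fN).
pose g x := if x == 0 then teval f t else a.
have eg : teval f (tpow t n) = teval g (tpow (Var 0) n).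
  by elim: (n) => //= m ->.
by rewrite eg; split; [exact: (e1 S NS g) | exact: (e2 S NS g)].
Qed.

Lemma null_with_letters t : exists2 p, null p & tletters p =i tletters t.
Proof.
have [n hn] := null_tpow; exists (tpow t n); first exact: hn.
by elim: n {hn} => //= n IHn x; rewrite mem_cat IHn orbb.
Qed.

Definition null_for (R : T -> T -> Prop) s : Prop := exists2 s', R s s' & null s'.

(** By [absorb_term], [s] is related to terms that contain any prescribed [p]; a high power of [s]
    is taken for [p]. *)
Lemma letters_null_for (R : T -> T -> Prop) s t :
  fully_invariant R -> R s t -> ~ tletters s =i tletters t ->
  exists s', [/\ R s s', null s' & tletters s' =i tletters s].
Proof.
move=> fR st ne; have [q [A [_ hA Aq Rq]]] := absorb_term fR st ne.
have [p np ps] := null_with_letters s.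
exists (tsubst (replace A p) q); split; first exact: Rq.
  exact: null_replace.
move=> b; rewrite tletters_replace // => c cq nA; rewrite ps; exact: Aq.
Qed.

Lemma linked_sub (R1 R2 R : T -> T -> Prop) s t : fully_invariant R ->
  (forall s t, R1 s t -> R s t) -> (forall s t, R2 s t -> R s t) ->
  linked R1 R2 s t -> R s t.
Proof.
move=> fR h1 h2; elim=> {s t} [s t [/h1|/h2] //|s|s t u _ h _ h'].
  exact: fi_refl.
exact: (fi_trans fR) h h'.
Qed.

Section NullTerms.
Variable M : variety U.
Hypothesis M_cases : (forall s t, Id M s t) \/ (forall s t, Id M s t <-> tletters s =i tletters t).

(** The congruence of the join of [M] and [N]. *)
Local Notation X := (fun s t => Id M s t /\ Id N s t).

(** [X]-steps keep the letters, so the first change of letters in the chain is an [R]-step, and the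
    term before it still has the letters of [s]. *)
Lemma linked_letters (R : T -> T -> Prop) s t :
  (forall s t, Id M s t <-> tletters s =i tletters t) ->
  linked X R s t -> ~ tletters s =i tletters t ->
  exists p1 p2, [/\ tletters p1 =i tletters s, R p1 p2 & ~ tletters p1 =i tletters p2].
Proof.
move=> hM st ne; apply: contrapT => nex; apply: ne => x.
suff /(_ (fun=> erefl)) : tletters s =i tletters s -> tletters t =i tletters s by move=> ->.
have : forall a b, linked X R a b -> tletters a =i tletters s -> tletters b =i tletters s.
  move=> a b; elim=> {a b} [a b [[/hM ab _]|ab]|//|a b c _ h _ h'] e.
  - by move=> y; rewrite -ab e.
  - case: (EM (tletters a =i tletters b)) => ab'; first by move=> y; rewrite -ab' e.
    by case: nex; exists a, b.
  - exact/h'/h.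
exact.
Qed.

(* Through [Y], [w] absorbs a term [p1] with the same letters; then [Z] changes
   the letters of [p1] inside it. *)
Lemma null_linked_full (Y Z : T -> T -> Prop) (w w' p1 p2 B : T) :
  (forall s t, Id M s t <-> tletters s =i tletters t) ->
  fully_invariant Y -> fully_invariant Z ->
  null w -> null w' -> Y w w' -> ~ tletters w =i tletters w' ->
  tletters p1 =i tletters w -> Z p1 p2 -> ~ tletters p1 =i tletters p2 ->
  {subset tletters w <= tletters B} ->
  exists W : T, [/\ null W, tletters W =i tletters B
    & linked (fun s t => X s t /\ Y s t) Z w W].
Proof.
move=> hM fY fZ nw nw' Yww' ne p1w Zp ne12 wB.
have [q [A [qE hA Aq Yq]]] := absorb_term fY Yww' ne.
have [q2 [A2 [q2E hA2 Aq2 Zq2]]] := absorb_term fZ Zp ne12.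
have nq : null q by case: qE => ->.
(* The term [w1] is zero with the letters of [w], hence [X]-equal to [w]; [P] is [Z]-equal to [p1]
   and has the letters of [B]. *)
pose w1 := tsubst (replace A p1) q; pose P := tsubst (replace A2 B) q2.
have nw1 : null w1 by exact: null_subst.
have w1w : tletters w1 =i tletters w.
  by move=> y; rewrite tletters_replace // => b bq nA; rewrite p1w; exact: Aq.
have PB : tletters P =i tletters B.
  apply: tletters_replace => // b bq nA; apply: wB; rewrite -p1w; exact: Aq2.
exists (tsubst (replace A P) q); split.
- exact: null_subst.
- move=> y; rewrite tletters_replace // => b bq nA.
  by rewrite PB; apply: wB; exact: Aq.
apply: (@rt_trans _ _ _ w1).
  apply: linked_l; split; last exact: Yq.
  by split; [apply/hM => y; rewrite w1w | exact: null_Id].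
apply: linked_r; apply: fi_tsubst => // b; rewrite /replace.
by case: ifP => // _; [exact: Zq2 | exact: fi_refl].
Qed.

Lemma null_linked (Y Z : T -> T -> Prop) w w' :
  fully_invariant Y -> fully_invariant Z -> (forall s t, Z s t -> Y s t) -> null w -> null w' -> Y w w' ->
  linked X Z w w' -> linked (fun s t => X s t /\ Y s t) Z w w'.
Proof.
move=> fY fZ ZY nw nw' Yww' lww'.
have nn : Id N w w' by exact: null_Id.
case: M_cases => hM; first by apply: linked_l; split=> //.
case: (EM (tletters w =i tletters w')) => e.
  by apply: linked_l; split=> //; split=> //; apply/hM.
have fX : fully_invariant X by apply: fi_and; exact: Id_fully_invariant.
have fL := linked_fully_invariant fX fZ.
have fL' := linked_fully_invariant (fi_and fX fY) fZ.
have e' : ~ tletters w' =i tletters w by move=> h; apply: e => y; rewrite h.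
have [p1 [p2 [p1w p12 ne]]] := linked_letters hM lww' e.
have [p1' [p2' [p1w' p12' ne']]] := linked_letters hM (fi_sym fL lww') e'.
have sub : {subset tletters w <= tletters (Mul w w')}.
  by move=> y yw; rewrite /= mem_cat yw.
have sub' : {subset tletters w' <= tletters (Mul w w')}.
  by move=> y yw; rewrite /= mem_cat yw orbT.
have [W [nW WB lW]] := null_linked_full hM fY fZ nw nw' Yww' e p1w p12 ne sub.
have [W' [nW' WB' lW']] :=
  null_linked_full hM fY fZ nw' nw (fi_sym fY Yww') e' p1w' p12' ne' sub'.
apply: (fi_trans fL' lW); apply: (fi_trans fL' _ (fi_sym fL' lW')).
(* Both [W] and [W'] are zero with the same letters, hence [X]-equal. They are [Y]-equal because
   every link stays inside [Y]. *)
apply: linked_l; split; first by split; [apply/hM => y; rewrite WB WB' | exact: null_Id].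
have LY a b : linked (fun s t => X s t /\ Y s t) Z a b -> Y a b.
  by apply: linked_sub => // ? ? [].
apply: (fi_trans fY _ (LY _ _ lW')); apply: (fi_trans fY _ Yww').
by apply: (fi_sym fY); exact: LY.
Qed.

End NullTerms.
End NilVariety.

(** * Words *)

Lemma mem_alph w x : (x \in alph w) = (x \in letters w).
Proof. by rewrite /alph /letters !inE. Qed.

Section Words.
Variable U : Type.
Implicit Types (u v w : word) (t : term U nat).

Definition wterm w : term U nat :=
  foldl (fun a x => Mul a (Var x)) (Var (whead w)) (wtail w).

Lemma teval_wterm (S : ualg U) (f : nat -> S) w : teval f (wterm w) = weval f w.
Proof.
rewrite /wterm /weval -[f (whead w)]/(teval f (Var (whead w))).
by elim: (wtail w) (Var _) => //= x l IHl a; rewrite IHl.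
Qed.

Lemma tletters_wterm w : tletters (wterm w) = letters w.
Proof.
rewrite /wterm /letters -[whead w :: _]/(tletters (Var (U := U) (whead w)) ++ _).
elim: (wtail w) (Var _) => [|x l IHl] a /=; first by rewrite cats0.
by rewrite IHl /= -catA.
Qed.

Lemma weval_cat (S : ualg U) (f : nat -> S) u v :
  weval f (wcat u v) = weval f u ** weval f v.
Proof.
rewrite /weval foldl_cat; move: (foldl _ _ (wtail u)) => a /=.
by elim: (wtail v) (f (whead v)) => //= x l IHl b; rewrite -IHl mulA.
Qed.

Fixpoint flatten_term t : option word :=
  match t with
  | Var x => Some (wletter x)
  | Mul s t => if (flatten_term s, flatten_term t) is (Some u, Some v)
               then Some (wcat u v) else None
  | Op _ _ => None
  end.

Lemma flatten_term_sound t w : flatten_term t = Some w ->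
  (forall (S : ualg U) (f : nat -> S), teval f t = weval f w) /\ tletters t = letters w.
Proof.
elim: t w => [x|s IHs t IHt|//] w /=; first by case=> <-.
case: (flatten_term s) IHs => // u /(_ _ erefl)[eu lu].
case: (flatten_term t) IHt => // v /(_ _ erefl)[ev lv] [<-]; split.
  by move=> S f; rewrite weval_cat eu ev.
by rewrite lu lv.
Qed.

Variable N : variety U.
Hypothesis opN : forall S, N S -> forall o (x : S), is_zero (uop o x).

(** A unary operation makes every term containing it zero; any other term is a word up to
    bracketing, in every variety. *)
Lemma not_null_word t : ~ null N t ->
  exists w, (forall V : variety U, Id V t (wterm w)) /\ tletters t = letters w.
Proof.
move=> nt; case E : (flatten_term t) => [w|].
  have [ew lw] := flatten_term_sound E; exists w; split=> // V S _ f.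
  by rewrite teval_wterm ew.
case: nt; elim: t E => [//|s IHs t IHt|o t _ _] /=; last exact: null_op.
case: (flatten_term s) IHs => [u _|/(_ erefl) h _]; last exact: null_mull.
by case: (flatten_term t) IHt => [//|/(_ erefl) h _]; exact: null_mulr.
Qed.

Lemma satisfiesP (V : variety U) u v : satisfies V u v <-> Id V (wterm u) (wterm v).
Proof.
by split=> h S VS f; have := h S VS f; rewrite !teval_wterm.
Qed.

Lemma satisfies0P w : satisfies0 N w <-> null N (wterm w).
Proof.
split=> [h S NS f a|h x _]; last first.
  split=> S NS f; have := h S NS f; rewrite teval_wterm !weval_cat.
    by move=> h'; rewrite (h' _).1 (h' _).2.
  by move=> h'; rewrite (h' _).2.
have [x xw] : exists x, x \notin letters w.
  (* A letter beyond all letters of [w] is fresh, so its value can be the arbitrary element [a]. *)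
  exists (\max_(y <- letters w) y).+1; apply/negP => h'.
  by have := @leq_bigmax_seq _ _ predT id _ h' isT; rewrite ltnn.
have xA : x \notin alph w by rewrite mem_alph.
have [h1 h2] := h x xA.
pose g y := if y == x then a else f y.
have eg : teval f (wterm w) = weval g w.
  rewrite -teval_wterm; apply: eq_in_teval => y.
  by rewrite tletters_wterm /g; case: eqP => // ->; rewrite (negPf xw).
have gx : weval g (wletter x) = a by rewrite /weval /= /g eqxx.
have := h1 S NS g; have := h2 S NS g; rewrite !weval_cat gx eg => e2 e1.
by rewrite e1 e2.
Qed.
End Words.

(** * Permutations acting on words *)

Section Renaming.
Variables (k : nat) (e : 'I_k -> nat).
Hypothesis je : injective e.
Implicit Types (s t : 'S_k) (w : word).

Lemma wrename_comp f g w : wrename f (wrename g w) = wrename (f \o g) w.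
Proof. by rewrite /wrename /= map_comp. Qed.

Lemma wrename_id f w : f =1 id -> wrename f w = w.
Proof.
by case: w => x l h; rewrite /wrename /= h; congr Word; rewrite -[RHS]map_id; apply: eq_map.
Qed.

Lemma letter_permM s t x :
  letter_perm e (s * t)%g x = letter_perm e t (letter_perm e s x).
Proof.
have [/codomP[i ->]|nx] := boolP (x \in codom e).
  by rewrite !letter_permE // permM.
have out r : letter_perm e r x = x.
  rewrite /letter_perm; case: pickP => // i /eqP ei.
  by rewrite -ei codom_f in nx.
by rewrite !out.
Qed.

Lemma letter_perm1 x : letter_perm e 1%g x = x.
Proof. by rewrite /letter_perm; case: pickP => // i /eqP <-; rewrite perm1. Qed.

Lemma word_permM s t w : word_perm e (s * t)%g w = word_perm e t (word_perm e s w).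
Proof.
by rewrite /word_perm wrename_comp; apply: eq_wrename => x _; exact: letter_permM.
Qed.

Lemma word_perm1 w : word_perm e 1%g w = w.
Proof. by apply: wrename_id => x; exact: letter_perm1. Qed.

Lemma satisfies_rename (U : Type) (V : variety U) f u v :
  satisfies V u v -> satisfies V (wrename f u) (wrename f v).
Proof. by move=> h S VS g; rewrite !weval_rename; exact: h. Qed.

Lemma satisfies_sym (U : Type) (V : variety U) u v : satisfies V u v -> satisfies V v u.
Proof. by move=> h S VS f; rewrite h. Qed.

Lemma satisfies_trans (U : Type) (V : variety U) v u w :
  satisfies V u v -> satisfies V v w -> satisfies V u w.
Proof. by move=> h h' S VS f; rewrite h // h'. Qed.

Lemma letters_wrename f w : letters (wrename f w) = map f (letters w).
Proof. by []. Qed.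

Lemma alph_word_perm s w : enumerates e (alph w) -> alph (word_perm e s w) = alph w.
Proof.
move=> [_ ew]; apply/fsetP => x.
have inA y : (y \in letters w) = (y \in codom e) by rewrite -ew mem_alph.
rewrite !mem_alph letters_wrename inA; apply/mapP/codomP.
  by move=> [y]; rewrite inA => /codomP[i ->] ->; exists (s i); rewrite letter_permE.
move=> [i ->]; exists (e ((s^-1)%g i)); first by rewrite inA codom_f.
by rewrite letter_permE // permKV.
Qed.

(** Renaming a word conjugates its stabilizer, as renamings preserve identities. *)
Lemma stab_word_perm (U : Type) (V : variety U) s t w :
  (t \in stab_on V e (word_perm e s w)) = ((t ^ s^-1)%g \in stab_on V e w).
Proof.
rewrite !inE; apply/asboolP/asboolP.
  move=> /(satisfies_rename (letter_perm e (s^-1)%g)).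
  by rewrite -/(word_perm _ _ _) -/(word_perm e _ _) -!word_permM mulgV word_perm1 conjgE invgK mulgA.
move=> /(satisfies_rename (letter_perm e s)).
rewrite -/(word_perm _ _ _) -/(word_perm e _ (word_perm _ _ _)) -!word_permM.
by rewrite conjgE invgK !mulgA mulgKV.
Qed.

End Renaming.

Lemma enumeration (A : {fset nat}) : exists (k : nat) (e : 'I_k -> nat), enumerates e A.
Proof.
exists (size (enum_fset A)), (tnth (in_tuple (enum_fset A))); split.
  move=> i j; rewrite !(tnth_nth 0) /= => /eqP.
  by rewrite nth_uniq ?fset_uniq // => /eqP/val_inj.
move=> x; apply/idP/codomP => [xA|[i ->]].
  have /tnthP[i ->] : x \in in_tuple (enum_fset A) by [].
  by exists i.
by have := mem_tnth i (in_tuple (enum_fset A)).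
Qed.

(** * Equivalent words *)

Section Equivalence.

Lemma letters_wcat u v : letters (wcat u v) = letters u ++ letters v.
Proof. by []. Qed.

Lemma endo_letters xi w : is_endo xi ->
  letters (xi w) = flatten [seq letters (xi (wletter x)) | x <- letters w].
Proof.
move=> hxi; case: w => x l.
elim: l x => [|y l IHl] x; first by rewrite /= cats0.
have -> : Word x (y :: l) = wcat (wletter x) (Word y l) by [].
by rewrite hxi letters_wcat IHl.
Qed.

Lemma size_flatten_ge (ss : seq (seq nat)) : all (fun s => 0 < size s) ss ->
  size ss <= size (flatten ss) ?= iff all (fun s => size s == 1) ss.
Proof.
elim: ss => [|s ss IHss] //= /andP[s0 /IHss h].
by rewrite size_cat -add1n; apply: leqif_add => //; split=> //; rewrite eq_sym.
Qed.

Lemma word_le_size u v : word_le u v -> size (letters u) <= size (letters v).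
Proof.
move=> [xi hxi [a [b ->]]]; rewrite !size_cat (endo_letters u hxi).
apply: leq_trans (leq_addl _ _); apply: leq_trans (leq_addr _ _).
rewrite -(size_map (fun x => letters (xi (wletter x)))).
by apply: (leqif_geq (size_flatten_ge _)); rewrite all_map; apply/allP.
Qed.

Lemma letters_inj u v : letters u = letters v -> u = v.
Proof. by case: u v => x l [y m] [-> ->]. Qed.

(** Equal lengths leave nothing on either side of the image of [u] and force each letter of [u] to
    go to a single letter. *)
Lemma word_le_rename u v : word_le u v -> size (letters u) = size (letters v) ->
  exists f, v = wrename f u.
Proof.
move=> [xi hxi [a [b vE]]] suv; exists (fun x => whead (xi (wletter x))).
have hall : all (fun s => 0 < size s) [seq letters (xi (wletter x)) | x <- letters u].
  by rewrite all_map; apply/allP.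
have := size_flatten_ge hall; rewrite size_map -(endo_letters u hxi) suv vE.
rewrite !size_cat => -[le eqE].
have /andP[/nilP a0 /nilP b0] : nilp a && nilp b by rewrite /nilp; lia.
apply: letters_inj; rewrite vE a0 b0 cats0 /= letters_wrename (endo_letters u hxi).
have : all (fun s => size s == 1) [seq letters (xi (wletter x)) | x <- letters u].
  by rewrite -eqE a0 b0 /= addn0.
elim: (letters u) => //= x l IHl /andP[/nilP x1 /IHl ->].
by rewrite x1.
Qed.

(** The renaming maps the common finite alphabet onto itself, so it is a permutation there. *)
Lemma word_equiv_perm (k : nat) (e : 'I_k -> nat) u v :
  enumerates e (alph u) -> alph u = alph v -> word_equiv u v ->
  exists s, v = word_perm e s u.
Proof.
move=> [je eu] uv [luv lvu].
have suv : size (letters u) = size (letters v).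
  by apply/eqP; rewrite eqn_leq !word_le_size.
have [f vE] := word_le_rename luv suv.
have inu x : (x \in letters u) = (x \in codom e) by rewrite -mem_alph eu.
have inv x : (x \in letters v) = (x \in codom e) by rewrite -mem_alph -uv eu.
have /fin_all_exists[h hE] i : exists j, e j = f (e i).
  have /codomP[j ->] : f (e i) \in codom e; last by exists j.
  by rewrite -inv vE letters_wrename map_f // inu codom_f.
have uh : uniq (codom h).
  apply: (leq_size_uniq (enum_uniq 'I_k)) => [j _|]; last by rewrite size_codom size_enum_ord card_ord.
  have : e j \in letters v by rewrite inv codom_f.
  rewrite vE letters_wrename => /mapP[x]; rewrite inu => /codomP[i ->].
  by rewrite -hE => /je ->; exact: codom_f.
have jh : injective h by apply/injectiveP.
exists (perm jh); rewrite vE; apply: eq_wrename => x; rewrite inu => /codomP[i ->].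
by rewrite letter_permE // permE hE.
Qed.
End Equivalence.

(** * Modularity *)

Lemma wterm_rename (U : Type) g w :
  wterm U (wrename g w) = tsubst (fun x => Var (g x)) (wterm U w).
Proof.
rewrite /wterm /= -[Var (g _)]/(tsubst (fun x => Var (g x)) (Var (U := U) (whead w))).
by elim: (wtail w) (Var _) => //= x l IHl a; rewrite -IHl.
Qed.

Lemma no_singular_pair (U : Type) (N : variety U) (k : nat) (e : 'I_k -> nat)
    (je : injective e) u v (Hu := Group (stab_on_group_set N u je))
    (Hv := Group (stab_on_group_set N v je)) :
  cond_c' N -> enumerates e (alph u) -> alph u = alph v -> ~ word_equiv u v ->
  modular_subgroup Hu -> modular_subgroup Hv ->
  singular_subgroup Hu -> ~ (singular_subgroup Hv \/ Hv = ('Alt_('I_k))%g :> {group 'S_k}).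
Proof.
rewrite /Hu /Hv {Hu Hv} => cc eu uv nuv mu mv su sv; apply: cc; exists u, v; split=> //.
have [k3|k4] : k = 3 \/ k = 4.
- by case: su => -[+ _]; rewrite card_ord; auto.
- subst k; have uT := singular_T3s su.
  case: sv => [/singular_T3s vT|/(congr1 val)/= vA].
    by constructor 1; exists e.
  by constructor 2; exists e; split=> //; rewrite vA inE.
- subst k; have uI := singular_I4s mu su.
  case: sv => [/(singular_I4s mv) vI|/(congr1 val)/= vA].
    by constructor 3; exists e.
  by constructor 4; exists e; split=> //; rewrite vA inE.
Qed.

Section Main.
Variables (U : Type) (M N : variety U).
Hypothesis nilN : nil_variety N.
Hypothesis opN : forall S, N S -> forall o (x : S), is_zero (uop o x).
Hypothesis M_cases : (forall s t : term U nat, Id M s t) \/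
  (forall s t : term U nat, Id M s t <-> tletters s =i tletters t).
Hypotheses (ca : cond_a N) (cb : cond_b N) (cc : cond_c' N).
Variables Y Z : variety U.
Hypothesis ZY : forall s t : term U nat, Id Z s t -> Id Y s t.

Local Notation T := (term U nat).
Local Notation X := (fun s t : T => Id M s t /\ Id N s t).
Local Notation IdZ := (Id Z (X := nat)).
Local Notation IdY := (Id Y (X := nat)).
Implicit Types (u v w : word) (s t : T).

Let fZ : fully_invariant IdZ := Id_fully_invariant Z.
Let fX : fully_invariant X := fi_and (Id_fully_invariant M) (Id_fully_invariant N).
Let fL : fully_invariant (linked X IdZ) := linked_fully_invariant fX fZ.
Let fL' : fully_invariant (linked (fun s t => X s t /\ Id Y s t) IdZ) :=
  linked_fully_invariant (fi_and fX (Id_fully_invariant Y)) fZ.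

Lemma Id_substitutive u v : Id N (wterm U u) (wterm U v) -> ~ null N (wterm U u) ->
  substitutive u v.
Proof.
move=> /satisfiesP uv nu; apply: contrapT => ns.
by have [/satisfies0P] := ca ns uv.
Qed.

Lemma null_null_for t : null N t -> null_for N IdZ t.
Proof. by move=> nt; exists t => //; exact: (fi_refl fZ). Qed.

Lemma null_for_Id s t : Id Z s t -> null_for N IdZ s -> null_for N IdZ t.
Proof. by move=> st [s' ss' ns']; exists s' => //; apply: (fi_trans fZ) ss'; exact: (fi_sym fZ). Qed.

(** By (a), an [X]-step between nonzero terms is a renaming; applied to a zero term [Z]-equal to
    [s], it gives one [Z]-equal to [t]. *)
Lemma null_for_step s t : X s t \/ Id Z s t -> null_for N IdZ s -> null_for N IdZ t.
Proof.
case=> [[_ st] zs|]; last exact: null_for_Id.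
case: (EM (null N t)) => [|nt]; first exact: null_null_for.
have ns : ~ null N s by move=> h; apply: nt; exact: Id_null st h.
have [u [us _]] := not_null_word opN ns; have [v [vt _]] := not_null_word opN nt.
have uv : Id N (wterm U u) (wterm U v).
  by move=> S NS f; rewrite -(us N) // -(vt N) //; exact: st.
have nu : ~ null N (wterm U u) by move=> h; apply: ns; apply: Id_null h => S NS f; rewrite (us N).
have [_ [g vE]] := Id_substitutive uv nu.
have [s' us' ns'] := null_for_Id (us Z) zs.
exists (tsubst (fun x => Var (letter_perm val g x)) s'); last exact: null_subst.
apply: (fi_trans fZ (vt Z)); rewrite vE wterm_rename; exact: (fi_subst fZ).
Qed.

Lemma null_for_linked s t : linked X IdZ s t -> null_for N IdZ s -> null_for N IdZ t.
Proof. by elim=> {s t} [s t /null_for_step //|//|s t u _ h _ h' /h/h']. Qed.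

(** * Chains of nonzero terms and subgroups of S_k *)

Section Core.
Variables (k : nat) (e : 'I_k -> nat) (u0 : word).
Hypothesis e_u0 : enumerates e (alph u0).
Hypothesis u0_nn : ~ null_for N IdZ (wterm U u0).
Let je : injective e := e_u0.1.

(** The words in the [Z]-class of [u0]. By [D_alph] they share its alphabet, so one enumeration [e]
    puts all stabilizers into the same S_k. *)
Let D w := satisfies Z w u0.
Let H w := Group (stab_on_group_set N w je).
Let K := Group (stab_on_group_set Z u0 je).
Let J := Group (stab_on_group_set Y u0 je).

Lemma D_not_null w : D w -> ~ null_for N IdZ (wterm U w).
Proof. by move=> /satisfiesP Dw h; apply: u0_nn; exact: null_for_Id h. Qed.

Lemma D_alph w : D w -> alph w = alph u0.
Proof.
move=> Dw; apply: contrapT => ne; case: (D_not_null Dw).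
have /satisfiesP Dw' := Dw.
have [|s' [h1 h2 _]] := letters_null_for nilN opN fZ Dw'; last by exists s'.
rewrite !tletters_wterm => h; apply: ne; apply/fsetP => x.
by rewrite !mem_alph h.
Qed.

Lemma D_enumerates w : D w -> enumerates e (alph w).
Proof. by move=> /D_alph ->. Qed.

Lemma D_modular w : D w -> modular_subgroup (H w).
Proof.
move=> Dw; apply: (enumerates_modular (D_enumerates Dw)).
have /cb/modular_subgroupP : ~ satisfies0 N w.
  by move=> /satisfies0P/null_null_for; exact: D_not_null.
exact.
Qed.

Lemma D_max : exists2 w, D w & forall w', D w' -> #|H w'| <= #|H w|.
Proof.
pose P n := `[< exists2 w, D w & #|H w| = n >].
have exP : exists n, P n.
  by exists #|H u0|; apply/asboolP; exists u0 => // S ZS f.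
have ubP n : P n -> n <= #|{perm 'I_k}|.
  by move=> /asboolP[w _ <-]; exact: max_card.
case: (ex_maxnP exP ubP) => n /asboolP[w Dw <-] hmax; exists w => // w' Dw'.
by apply: hmax; apply/asboolP; exists w'.
Qed.

Lemma H_sub w w' : D w -> (forall v, D v -> #|H v| <= #|H w|) -> D w' ->
  (H w' \subset H w <*> K)%g.
Proof.
move=> Dw wmax Dw'; case: (EM (word_equiv w' w)) => eqv.
  have [s wE] := word_equiv_perm (D_enumerates Dw') (etrans (D_alph Dw') (esym (D_alph Dw))) eqv.
  (* Modulo [Z], [u0] equals [w], the renaming of [w'] by [s], hence the renaming of [u0] by [s]. *)
  have sK : s \in K.
    rewrite inE; apply/asboolP; apply: (satisfies_trans (satisfies_sym Dw)).
    by rewrite wE; exact: satisfies_rename.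
  apply/subsetP => t tw'.
  have tsw : (t ^ s)%g \in H w by rewrite wE stab_word_perm // conjgK.
  rewrite -(conjgK s t); apply: groupJ.
    by apply: (subsetP (joing_subl _ _)).
  by rewrite groupV; apply: (subsetP (joing_subr _ _)).
suff : H w' \subset H w by move=> h; apply: subset_trans h (joing_subl _ _).
have alphE : alph w' = alph w by rewrite !D_alph.
case: (modular_comparable (D_modular Dw') (D_modular Dw)) => [//|sub|[sw' sw]|[sw wA]].
- by have /eqP -> : H w == H w' :> {set _} by rewrite eqEcard sub wmax.
- by have := no_singular_pair cc (D_enumerates Dw') alphE eqv (D_modular Dw') (D_modular Dw) sw' sw.
- have nqv : ~ word_equiv w w' by move=> [h h']; apply: eqv; split.
  by case: (no_singular_pair cc (D_enumerates Dw) (esym alphE) nqv (D_modular Dw) (D_modular Dw') sw); right.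
Qed.

(** An invariant of the chain: each term is nonzero modulo [Z] and [Z]-equal to a renaming of [u0]
    by an element of [G]. *)
Lemma linked_perm (G : {group 'S_k}) s t : (forall w, D w -> H w \subset G) ->
  linked X IdZ s t ->
  (~ null_for N IdZ s /\ exists2 g, g \in G & Id Z s (wterm U (word_perm e g u0))) ->
  (~ null_for N IdZ t /\ exists2 g, g \in G & Id Z t (wterm U (word_perm e g u0))).
Proof.
move=> DG; elim=> {s t} [a b step|//|s t v _ h _ h' /h/h' //] [na [g gG ag]].
have nb : ~ null_for N IdZ b.
  move=> h; apply: na; apply: null_for_step h.
  by case: step => [/(fi_sym fX)|/(fi_sym fZ)]; [left | right].
split=> //; case: step => [[_ ab]|ab]; last first.
  by exists g => //; apply: (fi_trans fZ) ag; exact: (fi_sym fZ).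
have nna : ~ null N a by move=> /null_null_for.
have nnb : ~ null N b by move=> /null_null_for.
have [u [ua _]] := not_null_word opN nna; have [v [vb _]] := not_null_word opN nnb.
have uv : Id N (wterm U u) (wterm U v).
  by move=> S NS f; rewrite -(ua N) // -(vb N) //; exact: ab.
have nu : ~ null N (wterm U u) by move=> h; apply: nna; apply: Id_null h => S NS f; rewrite (ua N).
have [_ [s vE]] := Id_substitutive uv nu.
have ug : satisfies Z u (word_perm e g u0).
  by apply/satisfiesP; apply: (fi_trans fZ) ag; apply: (fi_sym fZ).
(* Undoing [g] brings [u] back into the [Z]-class of [u0]. The renaming [h] of the [X]-step
   stabilizes [u], so its conjugate lies in the stabilizer of [w], hence in [G]. *)
pose w := word_perm e (g^-1)%g u.
have wg : u = word_perm e g w by rewrite -word_permM // mulVg word_perm1.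
have Dw : D w.
  have := satisfies_rename (letter_perm e (g^-1)%g) ug.
  by rewrite -/(word_perm _ _ (word_perm _ _ _)) -word_permM // mulgV word_perm1.
have eu : enumerates e (alph u) by rewrite wg alph_word_perm //; exact: D_enumerates.
have [h sh] := enumerates_perm eu s.
have {}vE : v = word_perm e h u by rewrite vE; apply: eq_wrename.
have hG : h \in G.
  rewrite -(conjgKV g h) groupJr //; apply: (subsetP (DG w Dw)).
  rewrite -stab_word_perm // -wg inE; apply/asboolP/satisfiesP.
  by rewrite -vE.
exists (g * h)%g; first exact: groupM.
apply: (fi_trans fZ (vb Z)); rewrite vE word_permM //; apply/satisfiesP.
exact: satisfies_rename.
Qed.

Local Notation L := (linked (fun s t => X s t /\ Id Y s t) IdZ).

Lemma linked_rename f u v : L (wterm U u) (wterm U v) ->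
  L (wterm U (wrename f u)) (wterm U (wrename f v)).
Proof. by rewrite !wterm_rename; exact: fi_subst. Qed.

(** Generators suffice. An element of [K] is a [Z]-step; for [s] in [H w] and [J] one passes from
    [u0] to [w] by [Z], renames [w] by [s], and returns by [Z]. *)
Lemma linked_word w g : D w -> (g \in (H w :&: J) <*> K)%g ->
  L (wterm U u0) (wterm U (word_perm e g u0)).
Proof.
move=> Dw; have /satisfiesP Dw' := Dw.
pose E := [set g | `[< L (wterm U u0) (wterm U (word_perm e g u0)) >]].
suff /subsetP sub : ((H w :&: J) <*> K \subset E)%g by move=> /sub; rewrite inE => /asboolP.
apply: gen_lmul_subset => [|s t].
  by rewrite inE; apply/asboolP; rewrite word_perm1 //; exact: (fi_refl fL').
rewrite !inE => sHK /asboolP ht; apply/asboolP; rewrite word_permM //.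
apply: (fi_trans fL' ht); apply: linked_rename.
case/orP: sHK => [/andP[/asboolP wws /asboolP uus]|/asboolP uus]; last first.
  by apply: linked_r; apply/satisfiesP.
apply: (fi_trans fL' (linked_r _ (fi_sym fZ Dw'))).
have /satisfiesP wus := satisfies_rename (letter_perm e s) Dw.
apply: (fi_trans fL' _ (linked_r _ wus)); apply: linked_l; split; last first.
  have fY := Id_fully_invariant Y; apply: (fi_trans fY (ZY Dw')).
  by apply: (fi_trans fY _ (fi_sym fY (ZY wus))); exact/satisfiesP.
split; last exact/satisfiesP.
case: M_cases => [//|hM]; apply/hM => x; rewrite !tletters_wterm -!mem_alph.
by rewrite -/(word_perm e s w) alph_word_perm //; exact: D_enumerates.
Qed.

Lemma linked_core t : Id Y (wterm U u0) t -> linked X IdZ (wterm U u0) t -> L (wterm U u0) t.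
Proof.
move=> uYt ut; have [w Dw wmax] := D_max.
have fY := Id_fully_invariant Y.
have [|_ [g gG tg]] := @linked_perm (H w <*> K)%G _ _ (fun w' => H_sub Dw wmax) ut.
  split=> //; exists 1%g; first exact: group1.
  by rewrite word_perm1 //; exact: (fi_refl fZ).
apply: (fi_trans fL' _ (linked_r _ (fi_sym fZ tg))).
apply: (linked_word Dw).
have KJ : K \subset J.
  by apply/subsetP => s; rewrite !inE => /asboolP/satisfiesP h; apply/asboolP/satisfiesP; exact: ZY.
(* The modular law for [H w], with [K] inside [J]. *)
apply: (subsetP (D_modular Dw KJ)); rewrite inE gG inE; apply/asboolP/satisfiesP.
exact: (fi_trans fY uYt (ZY tg)).
Qed.

End Core.

Lemma linked_meet s t : Id Y s t -> linked X IdZ s t ->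
  linked (fun s t => X s t /\ Id Y s t) IdZ s t.
Proof.
move=> st lst; have fY := Id_fully_invariant Y.
case: (EM (null_for N IdZ s)) => [zs|ns].
  have [s' ss' ns'] := zs; have [t' tt' nt'] := null_for_linked lst zs.
  apply: (fi_trans fL' (linked_r _ ss')).
  apply: (fi_trans fL' _ (linked_r _ (fi_sym fZ tt'))).
  apply: (null_linked M_cases (Id_fully_invariant Y)) => //.
    exact: (fi_trans fY (fi_sym fY (ZY ss')) (fi_trans fY st (ZY tt'))).
  apply: (fi_trans fL (linked_r _ (fi_sym fZ ss'))).
  exact: (fi_trans fL lst (linked_r _ tt')).
have nns : ~ null N s by move=> /null_null_for.
have [u [su _]] := not_null_word opN nns.
have [k [e eu]] := enumeration (alph u).
have nu : ~ null_for N IdZ (wterm U u).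
  by move=> h; apply: ns; apply: null_for_Id h; exact: (fi_sym fZ).
apply: (fi_trans fL' (linked_r _ (su Z))).
apply: (linked_core eu nu).
  exact: (fi_trans fY (fi_sym fY (su Y)) st).
exact: (fi_trans fL (linked_r _ (fi_sym fZ (su Z))) lst).
Qed.
End Main.

(** Serves both lattices: the condition on unary operations is vacuous for semigroups, and for nil
    epigroups it is [nil_epigroup_uop]. *)
Lemma nil_modular (U : Type) (M N : variety U) :
  nil_variety N ->
  (forall S, N S -> forall o (x : S), is_zero (uop o x)) ->
  (forall s t : term U nat, Id M s t) \/
    (forall s t : term U nat, Id M s t <-> tletters s =i tletters t) ->
  cond_a N -> cond_b N -> cond_c' N -> modular_element (M `|` N)%O.
Proof.
move=> nilN opN hM ca cb cc; apply: modular_variety => Y Z YZ s t st lst.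
have ZY (a b : term U nat) : Id Z a b -> Id Y a b by move=> h S YS; apply: h; move/asboolP: YZ; apply.
have /asboolP MV : (M <= M `|` N)%O := leUl _ _.
have /asboolP NV : (N <= M `|` N)%O := leUr _ _.
have VE (a b : term U nat) : Id (M `|` N)%O a b <-> Id M a b /\ Id N a b.
  split=> [h|[h h']]; last exact: Id_join.
  by split=> S hS; apply: h; [exact: MV | exact: NV].
have conv (R R' Q : term U nat -> term U nat -> Prop) a b :
    (forall a b, R a b -> R' a b) -> linked R Q a b -> linked R' Q a b.
  move=> RR'; elim=> {a b} [a b [/RR'|]|a|a b c _ h _ h'].
  - exact: linked_l.
  - exact: linked_r.
  - exact: rt_refl.
  - exact: rt_trans h h'.
apply: (conv (fun s t => (Id M s t /\ Id N s t) /\ Id Y s t)).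
  by move=> a b [/VE].
refine (linked_meet nilN opN hM ca cb cc ZY st _).
by apply: conv lst => a b /VE.
Qed.

Lemma Id_trivial (U : Type) (V : variety U) s t :
  (forall S, V S -> is_trivial S) -> Id V (X := nat) s t.
Proof. by move=> h S /h tS f; exact: tS. Qed.

Section Semilattice.
Variable U : Type.

(** The value of a term is the greatest lower bound of the values of its letters. *)
Lemma semilattice_teval (S : ualg U) (f : nat -> S) s t :
  is_semilattice S -> (forall o (x : S), uop o x = x) ->
  tletters s =i tletters t -> teval f s = teval f t.
Proof.
move=> [ii cc] oo.
have low x r : x \in tletters r -> teval f r ** f x = teval f r.
  elim: r => [y|r IHr q IHq|o r IHr] /=; last by rewrite oo.
    by rewrite inE => /eqP ->; rewrite ii.
  rewrite mem_cat => /orP[/IHr|/IHq] h; last by rewrite -mulA h.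
  by rewrite -mulA (cc (teval f q)) mulA h.
have glb g r : (forall x, x \in tletters r -> g ** f x = g) -> g ** teval f r = g.
  elim: r => [y|r IHr q IHq|o r IHr] /= h; last by rewrite oo IHr.
    by apply: h; rewrite inE.
  by rewrite mulA IHr ?IHq // => x hx; apply: h; rewrite mem_cat hx ?orbT.
move=> st; rewrite -(glb (teval f s) t) => [|x]; last by rewrite -st; exact: low.
by rewrite cc glb // => x; rewrite st; exact: low.
Qed.

Lemma bool_mulA (x y z : bool) : x && (y && z) = (x && y) && z.
Proof. exact: andbA. Qed.

(** The two-element semilattice; sending only [a] to [false] detects whether [a] occurs in a
    term. *)
Definition bool_ualg : ualg U :=
  @Ualg U bool andb (fun _ x => x) (inhabits true) bool_mulA.

Lemma bool_semilattice : is_semilattice bool_ualg.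
Proof. by split; [exact: andbb | exact: andbC]. Qed.

Lemma bool_teval a (t : term U nat) :
  teval (fun x => x != a : bool_ualg) t = (a \notin tletters t).
Proof.
elim: t => [x|s IHs t IHt|o t IHt] /=; first by rewrite inE eq_sym.
  by rewrite IHs IHt mem_cat negb_or.
exact: IHt.
Qed.

Lemma Id_semilattice (V : variety U) : V bool_ualg ->
  (forall S, V S -> is_semilattice S /\ forall o (x : S), uop o x = x) ->
  forall s t : term U nat, Id V s t <-> tletters s =i tletters t.
Proof.
move=> VB hV s t; split=> [h a|h S /hV[sS oS] f]; last exact: semilattice_teval.
by apply: negb_inj; rewrite -!bool_teval h.
Qed.
End Semilattice.

(** Epigroup varieties form a sublattice of all varieties with one unary operation, and modularity
    passes down to a sublattice. *)
Lemma modular_sub (d d' : Order.disp_t) (L : latticeType d) (L' : latticeType d')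
    (f : L' -> L) (x : L') :
  injective f -> {morph f : a b / (a `|` b)%O} -> {morph f : a b / (a `&` b)%O} ->
  modular_element (f x) -> modular_element x.
Proof.
move=> jf fU fI mx y z yz; apply: jf; rewrite fU !fI fU; apply: mx.
by rewrite leEmeet -fI; apply/eqP; congr f; apply/eqP; rewrite -leEmeet.
Qed.

(** The pseudoinverse of [x] is divisible by every power of [x], one of which is zero. *)
Lemma nil_epigroup_uop (S : ualg unit) :
  is_epigroup S -> is_nilsemigroup S -> forall o (x : S), is_zero (uop o x).
Proof.
move=> [_ hS] [z [z0 hz]] [] x.
have /pseudoinverse_drazin[n [c i _]] := hS x.
have yE k : exists b, uop tt x = pow x k ** b.
  elim: k => [|k [b yb]].
    by exists (uop tt x ** uop tt x); rewrite mulA -{1}i -c.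
  exists (b ** uop tt x); rewrite /= -mulA (mulA (pow x k)) -yb.
  by rewrite mulA c i.
have [k hk] := hz x; have [b ->] := yE k.
by rewrite hk (z0 b).1.
Qed.

Theorem theorem1p2 :
  (forall M N : SEM, M = SEM_T \/ M = SEM_SL ->
     nil_variety N -> cond_a N -> cond_b N -> cond_c' N ->
     modular_element (M `|` N)%O) /\
  (forall M N : EPI, M = EPI_T \/ M = EPI_SL ->
     nil_variety N -> cond_a N -> cond_b N -> cond_c' N ->
     modular_element (M `|` N)%O).
Proof.
split=> M N hM nilN ca cb cc.
  apply: nil_modular => //; case: hM => ->; [left=> s t|right].
    exact: Id_trivial.
  by apply: Id_semilattice => //; exact: bool_semilattice.
apply: (modular_sub (f := epi_variety)) => //; first exact: val_inj.
apply: nil_modular => //.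
  move=> S NS; apply: nil_epigroup_uop; last exact: nilN.
  by have /asboolP := epi_varietyP N; apply.
case: hM => ->; [left=> s t|right].
  exact: Id_trivial.
apply: Id_semilattice => [|S [eS sS]].
  split; last exact: bool_semilattice.
  by apply/(semilattice_drazin (bool_semilattice unit)) => x; split=> //=; rewrite ?andbb.
(* In a semilattice pseudoinversion is the identity map: [y x y = y] and [x y = x] give [y = x]. *)
split=> // -[] x; have [c i p] := (semilattice_drazin sS).1 eS x.
have [ii cc'] := sS; rewrite /= ii in p.
by rewrite -{1}i -mulA p -c p.
Qed.
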